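(* The time complexity for calculating the variable bounds $\underline{a_r},\overline{a_r},\overline{a'_r}$ ($r\in\{1,\dots,d\}$), $\underline{b},\overline{b},\overline{b'}$ and the big-M parameters $M_i^c$ ($i\in\{1,\dots,N\}$, $c\in\{+,-\}$) from the data $S$, $\varepsilon$, $P^+$, $P^-$ is $O(2^{d+1}N^{d+2}d)$.
   Context: Time complexity is measured in the number of elementary arithmetic operations and comparisons on real numbers. Let $S=(\bm{x}_i,z_i)_{i=1,\dots,N}$ be a set of $N\ge d+1$ points of $\mathbb{R}^{d+1}$ with $(\bm{x}_i)$ in general position in $\mathbb{R}^d$ (any $d+1$ of them affinely independent), $D$ the convex hull of $\{\bm{x}_1,\dots,\bm{x}_N\}$, $\varepsilon\ge 0$, $P^+,P^-\ge 1$ integers. For $c\in\{+,-\}$, $\neg c$ denotes the opposite sign. $A$ is the set of all affine functions $D\to\mathbb{R}$ (extended affinely to $\mathbb{R}^d$ when evaluated at $\bm{0}$); $[S]^{d+1}$ is the set of all subsets of $S$ composed of $d+1$ points. For $s=(\bm{x}_{i_k},z_{i_k})_{k=1,\dots,d+1}\in[S]^{d+1}$, $B(s,\varepsilon)=\{(\bm{x}_{i_k},z_{i_k}+e_k)_{k=1,\dots,d+1}:(e_k)\in\{-\varepsilon,+\varepsilon\}^{d+1}\}$ and $A^*_{\varepsilon,s}=\{g\in A: g\text{ interpolates some }s'\in B(s,\varepsilon)\}$; $A^*_\varepsilon(S)=\bigcup_{s\in[S]^{d+1}}A^*_{\varepsilon,s}$. Quantities: $\underline{a_r}=\min_{g\in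 A^*_\varepsilon(S)}\frac{\partial g}{\partial x_r}$, $\overline{a_r}=\max_{g\in A^*_\varepsilon(S)}\frac{\partial g}{\partial x_r}$, $\underline{b}=\min_{g\in A^*_\varepsilon(S)}g(\bm{0})$, $\overline{b}=\max_{g\in A^*_\varepsilon(S)}g(\bm{0})$, $\overline{a'_r}=\min(P^--1,P^+)(\overline{a_r}-\underline{a_r})$, $\overline{b'}=\min(P^--1,P^+)(\overline{b}-\underline{b})$, and $M_i^c=\min(P^c-1,P^{\neg c})\left(\max_{g\in A^*_\varepsilon(S)}g(\bm{x}_i)-\min_{g\in A^*_\varepsilon(S)}g(\bm{x}_i)\right)$. *)

(* Defs.v *)
From mathcomp Require Import all_boot all_order all_algebra.
From mathcomp Require Import classical_sets reals topology normedtype derive.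

Set Implicit Arguments.
Unset Strict Implicit.
Unset Printing Implicit Defensive.

Import Order.TTheory GRing.Theory Num.Theory.
Import numFieldNormedType.Exports.

Local Open Scope classical_set_scope.
Local Open Scope ring_scope.

(** * The quantities to be computed *)

Definition affinely_independent (R : realType) (d n : nat)
    (p : 'I_n -> 'rV[R]_d) : Prop :=
  forall l : 'I_n -> R,
    \sum_k l k = 0 -> \sum_k l k *: p k = 0 -> forall k, l k = 0.

Definition general_position (R : realType) (d N : nat)
    (x : 'I_N -> 'rV[R]_d) : Prop :=
  forall f : 'I_d.+1 -> 'I_N, injective f -> affinely_independent (x \o f).

(* In general position with N >= d+1, the convex hull D of the points spans
   R^d, so that an affine function on D is the same thing as (the restriction
   of) an affine function on R^d. *)
Definition affine_functions (R : realType) (d : nat) : set ('rV[R]_d -> R) :=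
  [set g | exists (a : 'I_d -> R) (b : R),
     forall u : 'rV[R]_d, g u = \sum_r a r * u 0 r + b].

(* Affine functions have constant partial derivatives, hence the choice of 0. *)
Definition partial (R : realType) (d : nat) (r : 'I_d)
    (g : 'rV[R]_d -> R) : R :=
  'D_(delta_mx 0 r) g 0.

Definition interpolates (R : realType) (d : nat) (g : 'rV[R]_d -> R)
    (s : set ('rV[R]_d * R)) : Prop :=
  forall p, s p -> g p.1 = p.2.

(* In general position (with d >= 1) the points of S are pairwise distinct, so
   the (d+1)-subsets of S are given by the (d+1)-subsets I of the indices. *)
Definition perturbed (R : realType) (d N : nat) (x : 'I_N -> 'rV[R]_d)
    (z : 'I_N -> R) (eps : R) (I : {set 'I_N}) : set (set ('rV[R]_d * R)) :=
  [set s' | exists e : 'I_N -> R,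
     (forall i, i \in I -> e i = - eps \/ e i = eps) /\
     s' = [set (x i, z i + e i) | i in [set` I]]].

Definition Astar_at (R : realType) (d N : nat) (x : 'I_N -> 'rV[R]_d)
    (z : 'I_N -> R) (eps : R) (I : {set 'I_N}) : set ('rV[R]_d -> R) :=
  [set g | affine_functions g /\
     exists2 s', perturbed x z eps I s' & interpolates g s'].

Definition Astar (R : realType) (d N : nat) (x : 'I_N -> 'rV[R]_d)
    (z : 'I_N -> R) (eps : R) : set ('rV[R]_d -> R) :=
  \bigcup_(I in [set I : {set 'I_N} | #|I| = d.+1]) Astar_at x z eps I.

Definition is_min (R : realType) (E : set R) (m : R) : Prop :=
  E m /\ lbound E m.
Definition is_max (R : realType) (E : set R) (m : R) : Prop :=
  E m /\ ubound E m.

(* Signs are booleans, true standing for + and false for -. *)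
Record bounds (R : realType) (d N : nat) : Type := Bounds {
  a_lo : 'I_d -> R;
  a_hi : 'I_d -> R;
  a_diff : 'I_d -> R;
  b_lo : R;
  b_hi : R;
  b_diff : R;
  bigM : 'I_N -> bool -> R
}.

Definition is_bounds (R : realType) (d N : nat) (x : 'I_N -> 'rV[R]_d)
    (z : 'I_N -> R) (eps : R) (P : bool -> nat) (v : bounds R d N) : Prop :=
  let A := Astar x z eps in
  let fac c : R := (minn (P c - 1) (P (~~ c)))%:R in
  [/\ forall r, [/\ is_min [set partial r g | g in A] (a_lo v r),
                    is_max [set partial r g | g in A] (a_hi v r) &
                    a_diff v r = fac false * (a_hi v r - a_lo v r)],
      [/\ is_min [set g 0 | g in A] (b_lo v),
          is_max [set g 0 | g in A] (b_hi v) &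
          b_diff v = fac false * (b_hi v - b_lo v)] &
      forall i c, exists lo hi : R,
        [/\ is_min [set g (x i) | g in A] lo,
            is_max [set g (x i) | g in A] hi &
            bigM v i c = fac c * (hi - lo)]].

(** * Real random access machine *)

(* The machine has an integer memory for loop counters and addresses, and a
   real memory organised in two-dimensional arrays, both indirectly addressed.
   Information flows from the reals to the integers only through comparisons
   of reals.  A program does not depend on the size of the data.
   The running time is the number of arithmetic operations and comparisons on
   real numbers; integer operations, control flow, copies and the loading of
   the constants 0 and 1 are not counted.
   All loops are bounded, so that every program terminates; this restricts the
   class of algorithms. *)

Inductive nexp : Type :=
| NConst of nat
| NCell of nexp
| NAdd of nexp & nexp
| NSub of nexp & nexp
| NMul of nexp & nexp
| NDiv of nexp & nexp
| NMod of nexp & nexp.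

(* array, row and column *)
Inductive addr : Type := Addr of nexp & nexp & nexp.

Inductive rop : Type := RAdd | RSub | RMul | RDiv.

Inductive cmd : Type :=
| Skip
| Seq of cmd & cmd
| NSet of nexp & nexp
| RConst of addr & bool
| RCopy of addr & addr
| ROp of rop & addr & addr & addr (* destination first *)
| IfN of nexp & nexp & cmd & cmd
| IfR of addr & addr & cmd & cmd
| For of nexp & nexp & cmd.

Record state (R : realType) : Type := State {
  imem : nat -> nat;
  rmem : nat -> nat -> nat -> R
}.

Definition set_int (R : realType) (s : state R) (k v : nat) : state R :=
  State (fun k' => if k' == k then v else imem s k') (rmem s).

Fixpoint neval (m : nat -> nat) (e : nexp) : nat :=
  match e with
  | NConst n => n
  | NCell e1 => m (neval m e1)
  | NAdd e1 e2 => (neval m e1 + neval m e2)%N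
  | NSub e1 e2 => (neval m e1 - neval m e2)%N
  | NMul e1 e2 => (neval m e1 * neval m e2)%N
  | NDiv e1 e2 => (neval m e1 %/ neval m e2)%N
  | NMod e1 e2 => (neval m e1 %% neval m e2)%N
  end.

Definition get_real (R : realType) (s : state R) (l : addr) : R :=
  let: Addr a i j := l in
  rmem s (neval (imem s) a) (neval (imem s) i) (neval (imem s) j).

Definition set_real (R : realType) (s : state R) (l : addr) (v : R) : state R :=
  let: Addr a i j := l in
  let e := neval (imem s) in
  State (imem s) (fun a' i' j' =>
    if [&& a' == e a, i' == e i & j' == e j] then v else rmem s a' i' j').

(* Division by 0 returns 0, as in the library. *)
Definition apply_rop (R : realType) (o : rop) (u v : R) : R :=
  match o with
  | RAdd => u + v
  | RSub => u - v
  | RMul => u * v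
  | RDiv => u / v
  end.

(* Final state and running time.  In [For k n c] the address k and the bound n
   are evaluated once, and c is run with cell k set to 0, ..., n-1. *)
Fixpoint exec (R : realType) (c : cmd) (s : state R) : state R * nat :=
  match c with
  | Skip => (s, 0%N)
  | Seq c1 c2 =>
      let: (s1, t1) := exec c1 s in
      let: (s2, t2) := exec c2 s1 in (s2, (t1 + t2)%N)
  | NSet k e => (set_int s (neval (imem s) k) (neval (imem s) e), 0%N)
  | RConst l b => (set_real s l b%:R, 0%N)
  | RCopy l l1 => (set_real s l (get_real s l1), 0%N)
  | ROp o l l1 l2 =>
      (set_real s l (apply_rop o (get_real s l1) (get_real s l2)), 1%N)
  | IfN e1 e2 c1 c2 =>
      if (neval (imem s) e1 <= neval (imem s) e2)%N
      then exec c1 s else exec c2 s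
  | IfR l1 l2 c1 c2 =>
      let: (s', t) := if get_real s l1 <= get_real s l2
                      then exec c1 s else exec c2 s in (s', t.+1)
  | For k e c1 =>
      let cell := neval (imem s) k in
      iteri (neval (imem s) e)
        (fun i st => let: (s', t) := exec c1 (set_int st.1 cell i) in
                     (s', (st.2 + t)%N))
        (s, 0%N)
  end.

(* Integer cells 0 and 1 hold d and N; real array 0 holds the x_i as rows,
   array 1 the z_i and array 2 the numbers eps, P^+ and P^-.  All other cells
   are 0. *)
Definition input (R : realType) (d N : nat) (x : 'I_N -> 'rV[R]_d)
    (z : 'I_N -> R) (eps : R) (P : bool -> nat) : state R :=
  State
    (fun k => nth 0%N [:: d; N] k)
    (fun a i j =>
       match a with
       | 0%N => if insub i is Some i' then
                  if insub j is Some j' then x i' 0 j' else 0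
                else 0
       | 1%N => if insub i is Some i' then if j == 0%N then z i' else 0 else 0
       | 2%N => if j == 0%N
                then nth 0 [:: eps; (P true)%:R; (P false)%:R] i else 0
       | _ => 0
       end).

Definition output (R : realType) (d N : nat) (s : state R) : bounds R d N :=
  {| a_lo := fun r => rmem s 3%N r 0%N;
     a_hi := fun r => rmem s 3%N r 1%N;
     a_diff := fun r => rmem s 3%N r 2%N;
     b_lo := rmem s 4%N 0%N 0%N;
     b_hi := rmem s 4%N 0%N 1%N;
     b_diff := rmem s 4%N 0%N 2%N;
     bigM := fun i c => rmem s 5%N i (if c then 0%N else 1%N) |}.

(* Main.v *)
(* The program enumerates the codes t < N^(d+1) of (d+1)-tuples of indices.  For
   each injective tuple, the Gram-Schmidt process applied to the rows (x_i, 1)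
   costs O(d^3) operations; it never divides by zero because general position
   makes these rows linearly independent, so no pivoting is needed.  Then, for
   each of the 2^(d+1) sign patterns, the coefficients y = (a, b) of the
   interpolating affine function are obtained from 0 by moving along the l-th
   residue so as to satisfy the l-th equation: the residue is orthogonal to the
   previous rows, so the previous equations are not disturbed.  This costs
   O(d^2).  All quantities to be bounded are dot products of y with one of
   N + d + 1 fixed vectors, so updating their extrema costs O(N d).  As
   d^3 = O(2^d N d), each tuple costs O(2^(d+1) N d) in total. *)

Require Import Defs.
From mathcomp Require Import all_boot all_order all_algebra.
From mathcomp Require Import boolp classical_sets reals topology normedtype derive.
From mathcomp Require Import ring zify.

Set Implicit Arguments.
Unset Strict Implicit.
Unset Printing Implicit Defensive.

Import Order.TTheory GRing.Theory Num.Theory.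
Import numFieldNormedType.Exports.

Local Open Scope classical_set_scope.
Local Open Scope ring_scope.

(** * Hoare-style rules with a time budget *)

Definition runs (R : realType) (c : cmd) (s : state R) (T : nat)
    (Q : state R -> Prop) : Prop :=
  Q (exec c s).1 /\ ((exec c s).2 <= T)%N.

Lemma runs_weaken (R : realType) c (s : state R) T T' (Q Q' : state R -> Prop) :
  runs c s T Q -> (T <= T')%N -> (forall s', Q s' -> Q' s') -> runs c s T' Q'.
Proof. by move=> [q t] le_T QQ'; split; [exact: QQ'|exact: leq_trans le_T]. Qed.

Lemma runs_seq (R : realType) c1 c2 (s : state R) T1 T2 (Q1 Q : state R -> Prop) :
  runs c1 s T1 Q1 -> (forall s1, Q1 s1 -> runs c2 s1 T2 Q) ->
  runs (Seq c1 c2) s (T1 + T2) Q.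
Proof.
rewrite /runs /=; case: (exec c1 s) => s1 t1 /= [q1 le1] /(_ _ q1).
by case: (exec c2 s1) => s2 t2 /= [q2 le2]; split=> //; exact: leq_add.
Qed.

(** For a straight-line [c1] the final state and the cost compute, so no intermediate assertion is
    needed. The cost then appears as a literal 0 or 1, which is why later budgets are spelled out as
    sums with one summand per command. *)
Lemma runs_step (R : realType) c1 c2 (s : state R) T (Q : state R -> Prop) :
  runs c2 (exec c1 s).1 T Q -> runs (Seq c1 c2) s ((exec c1 s).2 + T) Q.
Proof. by move=> h; apply: (@runs_seq _ _ _ _ _ _ (eq (exec c1 s).1)) => // _ <-. Qed.

(** The invariant is indexed by the number of completed iterations. The counter address and the
    bound are read in the initial state only, so the body may overwrite the cells they mention. *)
Lemma runs_for (R : realType) k e c (s : state R) n T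
    (I : nat -> state R -> Prop) :
  neval (imem s) e = n -> I 0%N s ->
  (forall i s', (i < n)%N -> I i s' ->
     runs c (set_int s' (neval (imem s) k) i) T (I i.+1)) ->
  runs (For k e c) s (n * T) (I n).
Proof.
rewrite /runs /= => -> I0 step; elim: {-2}n (leqnn n) => [|i IHi] //= le_i.
have [Ii t_i] := IHi (ltnW le_i); move: (step _ _ le_i Ii).
case: (exec c _) => s' t /= [Is' le_t]; split=> //.
by rewrite mulSn addnC leq_add.
Qed.

(** The lists name what may be modified: single integer cells, but real arrays only as a whole. The
    tuple lives in cells [20 + k], so that its absence from a literal list of smaller numbers is
    decided by computation. *)
Definition frame (R : realType) (ks arrs : seq nat) (s s' : state R) : Prop :=
  (forall k, k \notin ks -> imem s' k = imem s k) /\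
  (forall a, a \notin arrs -> rmem s' a = rmem s a).

Lemma frame_refl (R : realType) ks arrs (s : state R) : frame ks arrs s s.
Proof. by []. Qed.

Lemma frame_trans (R : realType) ks arrs ks' arrs' (s s1 s2 : state R) :
  frame ks arrs s s1 -> frame ks' arrs' s1 s2 ->
  all (mem ks) ks' -> all (mem arrs) arrs' -> frame ks arrs s s2.
Proof.
move=> [Fi Fr] [Fi' Fr'] /allP sub_k /allP sub_a; split=> [k|a] out.
  by rewrite Fi' ?Fi //; apply: contra out => /sub_k.
by rewrite Fr' ?Fr //; apply: contra out => /sub_a.
Qed.

Lemma frame_sub (R : realType) ks arrs ks' arrs' (s s' : state R) :
  frame ks arrs s s' -> all (mem ks') ks -> all (mem arrs') arrs ->
  frame ks' arrs' s s'.
Proof. by move=> F; apply: frame_trans; last exact: F. Qed.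

(** Each write is compared with the cell or array at hand; a coincidence contradicts its absence
    from the list. *)
Ltac frame_tac :=
  let h := fresh in
  split=> [?|?] h; [|apply/funext=> ?; apply/funext=> ?]; rewrite /=;
  repeat (case: eqP => [?|_] /=; [by subst; move: h|]);
  by [|auto | match goal with F : _ |- _ => by rewrite F end].

(* Integer cells: 2: d+1, 3: N^(d+1), 4: 2^(d+1), 5: tuple code t, 6: sign
   code q, 7: whether array 6 is initialised, 8: positive iff the tuple is
   injective, 9-12: loop counters, 13: running quotient of t or q, 14: row of
   the next operand, 20+k: k-th index of the tuple.
   Real arrays: 6: minima (column 0) and maxima (column 1) of the functionals,
   7: the factors of the big-M formulas, 8: scratch, 10: the functionals,
   12: Gram-Schmidt residues, and the current solution in row d+1, 13: squared
   norms of the residues, 14: perturbed right-hand side, 15: zeros. *)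
Local Notation ic n := (NCell (NConst n)).
Local Notation loc a i j := (Addr (NConst a) i j).
Local Notation acc := (loc 8 (NConst 0) (NConst 0)).
Local Notation tmp := (loc 8 (NConst 0) (NConst 1)).
Local Infix ";;" := Seq (at level 60, right associativity).

(** * Dot products and sweeps along residues *)

Definition dot_prog : cmd :=
  RConst acc false ;;
  For (NConst 11) (ic 2)
    (ROp RMul tmp (loc 10 (ic 14) (ic 11)) (loc 12 (ic 9) (ic 11)) ;;
     ROp RAdd acc acc tmp).

Definition dot (R : realType) (n : nat) (u v : nat -> R) : R :=
  \sum_(j < n) u j * v j.

Lemma runs_dot (R : realType) (s : state R) :
  runs dot_prog s (2 * imem s 2) (fun s' => frame [:: 11] [:: 8] s s' /\
    rmem s' 8 0 0 =
      dot (imem s 2) (rmem s 10 (imem s 14)) (rmem s 12 (imem s 9))).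
Proof.
apply: (@runs_weaken _ _ _ (0 + imem s 2 * 2)); last 2 first.
- by rewrite mulnC.
- by move=> s'; exact.
apply: runs_step; apply: (@runs_for _ _ _ _ _ _ _ (fun j s' =>
  frame [:: 11] [:: 8] s s' /\ rmem s' 8 0 0 =
      dot j (rmem s 10 (imem s 14)) (rmem s 12 (imem s 9)))) => //.
  split; first frame_tac.
  by rewrite /dot big_ord0.
move=> j s' ltj [F eq_s']; split=> //=; split.
  case: F => F1 F2; frame_tac.
by rewrite eq_s' !F.1 // !F.2 // /dot big_ord_recr.
Qed.

Definition axpy_prog : cmd :=
  For (NConst 11) (ic 2)
    (ROp RMul tmp acc (loc 12 (ic 10) (ic 11)) ;;
     ROp RAdd (loc 12 (ic 9) (ic 11)) (loc 12 (ic 9) (ic 11)) tmp).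

(** The array [w] holds the prescribed dot products with the rows of the tuple. With the zero array
    15 this is a Gram-Schmidt step; with array 14 it solves the interpolation equations. *)
Definition sweep_prog (w : nat) : cmd :=
  For (NConst 10) (ic 9)
    (NSet (NConst 14) (NCell (NAdd (NConst 20) (ic 10))) ;;
     dot_prog ;;
     ROp RSub acc (loc w (ic 10) (NConst 0)) acc ;;
     ROp RDiv acc acc (loc 13 (ic 10) (NConst 0)) ;;
     axpy_prog).

Lemma runs_axpy (R : realType) (s : state R) :
  let k := imem s 9 in let l := imem s 10 in l != k ->
  runs axpy_prog s (imem s 2 * 2) (fun s' => [/\ frame [:: 11] [:: 8; 12] s s',
    forall i j, i != k -> rmem s' 12 i j = rmem s 12 i j &
    forall j, (j < imem s 2)%N ->
      rmem s' 12 k j = rmem s 12 k j + rmem s 8 0 0 * rmem s 12 l j]).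
Proof.
(* The invariant also says that the entries from [n] on are still the original ones, since the next
   iteration reads one of them. *)
move=> k l lNk; pose I n s' := [/\ frame [:: 11] [:: 8; 12] s s',
    rmem s' 8 0 0 = rmem s 8 0 0,
    forall i j, i != k -> rmem s' 12 i j = rmem s 12 i j &
    forall j, rmem s' 12 k j = if (j < n)%N then
      rmem s 12 k j + rmem s 8 0 0 * rmem s 12 l j else rmem s 12 k j].
apply: (@runs_weaken _ _ _ (imem s 2 * 2) _ (I (imem s 2))) => //; last first.
  by move=> s' [F _ other row]; split=> // j ltj; rewrite row ltj.
apply: runs_for => // n s' ltn [F acc_s' other row]; split=> //=; split=> //=.
- by case: F => F1 F2; frame_tac.
- move=> i j ik; rewrite !F.1 //.
  by rewrite -/k (negbTE ik) /= other.
- move=> j; rewrite !F.1 // -/k -/l eqxx /= ltnS leq_eqVlt.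
  case: eqP => [->|_] /=; last by rewrite row.
  by rewrite row ltnn acc_s' other.
Qed.

(** Row [P l] is the residue of [A l]: congruent to it modulo the previous rows and orthogonal to
    them. Hence [sq l] is also the squared norm of [P l]; it is the divisor used by the sweep. *)
Definition orthogonalized (R : realType) (n : nat) (A P : nat -> nat -> R)
    (sq : nat -> R) (l : nat) : Prop :=
  [/\ forall m, (m < l)%N -> dot n (A m) (P l) = 0,
      sq l = dot n (A l) (P l), sq l != 0 &
      exists c : nat -> R, forall j, (j < n)%N ->
        P l j = A l j + \sum_(m < l) c m * A m j].

Lemma eq_dot (R : realType) n (u v v' : nat -> R) :
  (forall j, (j < n)%N -> v j = v' j) -> dot n u v = dot n u v'.
Proof. by move=> eq_v; apply: eq_bigr => j _; rewrite eq_v. Qed.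

Lemma dotD (R : realType) n (u v w : nat -> R) a :
  dot n u (fun j => v j + a * w j) = dot n u v + a * dot n u w.
Proof. by rewrite /dot mulr_sumr -big_split; apply: eq_bigr => j _ /=; ring. Qed.

(** Moving along residue i by the defect of equation i divided by [sq i] cancels that defect, and
    orthogonality preserves the earlier equations. The last clause, that the row moves only within
    the span of the previous rows, is what makes the outcome a residue in Gram-Schmidt. *)
Lemma runs_sweep (R : realType) w (s : state R) :
  let n := imem s 2 in let k := imem s 9 in
  let A l := rmem s 10 (imem s (20 + l)) in
  w \notin [:: 8; 12]%N ->
  (forall l, (l < k)%N -> 
     orthogonalized n A (rmem s 12) (fun l => rmem s 13 l 0) l) ->
  runs (sweep_prog w) s (k * (4 * n + 2)) (fun s' =>
    [/\ frame [:: 10; 11; 14] [:: 8; 12] s s',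
        forall i j, i != k -> rmem s' 12 i j = rmem s 12 i j,
        forall l, (l < k)%N -> dot n (A l) (rmem s' 12 k) = rmem s w l 0 &
        exists c : nat -> R, forall j, (j < n)%N ->
          rmem s' 12 k j = rmem s 12 k j + \sum_(m < k) c m * A m j]).
Proof.
move=> n k A wP gs.
apply: (@runs_for _ _ _ _ _ _ _ (fun i s' =>
    [/\ frame [:: 10; 11; 14] [:: 8; 12] s s',
        forall i j, i != k -> rmem s' 12 i j = rmem s 12 i j,
        forall l, (l < i)%N -> dot n (A l) (rmem s' 12 k) = rmem s w l 0 &
        exists c : nat -> R, forall j, (j < n)%N ->
          rmem s' 12 k j = rmem s 12 k j + \sum_(m < i) c m * A m j])) => //.
  split=> //; exists (fun _ => 0) => j _; by rewrite big_ord0 addr0.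
move=> i s' lti [F other fits [c cP]].
(* The dot product and the move cost 2n operations each, the subtraction and the division one
   each. *)
have -> : (4 * n + 2 = 0 + (2 * n + (1 + (1 + n * 2))))%N by lia.
apply: runs_step; set s1 := (exec _ _).1.
have F1 : frame [:: 10; 11; 14] [:: 8; 12] s s1 by case: F => ? ?; frame_tac.
have n1 : imem s1 2 = n by rewrite F1.1.
have k1 : imem s1 9 = k by rewrite F1.1.
have i1 : imem s1 10 = i by [].
have d1 : imem s1 14 = imem s (20 + i) by rewrite /s1 /= F.1.
have r1 : rmem s1 12 = rmem s' 12 by [].
have dot1 := runs_dot s1; rewrite n1 k1 d1 r1 in dot1; apply: (runs_seq dot1) => {dot1}.
move: s1 F1 n1 k1 i1 d1 r1 => s1 F1 n1 k1 i1 d1 r1 s2 [F2].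
rewrite F1.2 // -/(A i) => dot2.
apply: runs_step; apply: runs_step; set s3 := (exec _ _).1.
have F3 : frame [:: 10; 11; 14] [:: 8; 12] s1 s3.
  have [//|//|? ?] := @frame_sub _ _ _ [:: 10; 11; 14] [:: 8; 12] _ _ F2; frame_tac.
have r3 : rmem s3 12 = rmem s2 12 by [].
have {}r3 a j : rmem s3 12 a j = rmem s' 12 a j by rewrite r3 F2.2 // r1.
have i3 : imem s3 10 = i by rewrite /s3 /= F2.1.
have k3 : imem s3 9 = k by rewrite /s3 /= F2.1.
have n3 : imem s3 2 = n by rewrite /s3 /= F2.1.
have acc3 : rmem s3 8 0 0 =
    (rmem s w i 0 - dot n (A i) (rmem s' 12 k)) / rmem s 13 i 0.
  rewrite /s3 /= dot2 !F2.1 // i1 !F2.2 //.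
  move: wP; rewrite !inE negb_or => /andP[wN8 wN12].
  by rewrite !F1.2 // !inE negb_or wN8.
  by move: wP; rewrite !inE negb_or => /andP[].
have [ortho sqE sq_neq0 [c' c'P]] := gs i lti.
have iNk : i != k by rewrite neq_ltn lti.
clearbody s3; have axpy3 := @runs_axpy _ s3; rewrite i3 k3 n3 /= in axpy3.
apply: (runs_weaken (axpy3 iNk)) => // s4 [F4 other4 row4] {axpy3}.
set al := (_ / _) in acc3.
have {}row4 j : (j < n)%N ->
    rmem s4 12 k j = rmem s' 12 k j + al * rmem s 12 i j.
  by move=> ltj; rewrite row4 // acc3 !r3 (other i).
split.
- exact: (frame_trans (frame_trans F1 F3 isT isT) F4 isT isT).
- by move=> i' j i'Nk; rewrite other4 // r3 other.
- move=> l; rewrite ltnS => le_l.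
  rewrite (eq_dot _ row4) dotD; case: ltngtP le_l => // [ltl|->] _.
    by rewrite fits // ortho // mulr0 addr0.
  by rewrite -sqE /al mulfVK // addrC subrK.
(* Residue i is [A i] plus the combination of earlier rows with coefficients [c']; scaling by [al]
   yields [al] at i and adds [al * c' m] below. *)
- exists (fun m => if (m < i)%N then c m + al * c' m else al) => j ltj.
  rewrite row4 // cP // c'P // big_ord_recr /= ltnn.
  rewrite [in RHS](eq_bigr (fun m : 'I_i => c m * A m j + al * (c' m * A m j))).
    by rewrite big_split -mulr_sumr /=; ring.
  by move=> m _; rewrite ltn_ord; ring.
Qed.

(** * The Gram-Schmidt process *)

Definition copy_prog (a : nat) : cmd :=
  For (NConst 11) (ic 2) (RCopy (loc 12 (ic 9) (ic 11)) (loc a (ic 14) (ic 11))).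

Definition gram_schmidt_prog : cmd :=
  For (NConst 9) (ic 2)
    (NSet (NConst 14) (NCell (NAdd (NConst 20) (ic 9))) ;;
     copy_prog 10 ;;
     sweep_prog 15 ;;
     NSet (NConst 14) (NCell (NAdd (NConst 20) (ic 9))) ;;
     dot_prog ;;
     RCopy (loc 13 (ic 9) (NConst 0)) acc).

Lemma runs_copy (R : realType) a (s : state R) :
  a != 12%N ->
  runs (copy_prog a) s 0 (fun s' => [/\ frame [:: 11] [:: 12] s s',
    forall i, i != imem s 9 -> rmem s' 12 i = rmem s 12 i &
    forall j, (j < imem s 2)%N ->
      rmem s' 12 (imem s 9) j = rmem s a (imem s 14) j]).
Proof.
move=> aN; apply: (@runs_weaken _ _ _ (imem s 2 * 0)); last 2 first.
- by rewrite muln0.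
- by move=> ?; exact.
apply: (@runs_for _ _ _ _ _ _ _ (fun n s' =>
  [/\ frame [:: 11] [:: 12] s s',
    forall i, i != imem s 9 -> rmem s' 12 i = rmem s 12 i &
    forall j, (j < n)%N ->
      rmem s' 12 (imem s 9) j = rmem s a (imem s 14) j])) => //.
move=> n s' ltn [F other row]; split=> //=; split=> //=.
- by case: F => F1 F2; frame_tac.
- move=> i iN; apply/funext => j.
  by rewrite F.1 // (negbTE iN) /= other.
- move=> j; rewrite !F.1 // eqxx ltnS leq_eqVlt /=.
  case: eqP => [->|_] /=; first by rewrite F.2 // inE.
  exact: row.
Qed.

Definition independent (R : realType) (n : nat) (A : nat -> nat -> R) : Prop :=
  forall c : nat -> R,
    (forall j, (j < n)%N -> \sum_(m < n) c m * A m j = 0) ->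
    forall m, (m < n)%N -> c m = 0.

Lemma dot_self_eq0 (R : realType) n (v : nat -> R) :
  dot n v v = 0 -> forall j, (j < n)%N -> v j = 0.
Proof.
move=> /eqP; rewrite psumr_eq0 => [/allP v0 j ltj|j _]; last first.
  by rewrite -expr2 sqr_ge0.
by have := v0 (Ordinal ltj) (mem_index_enum _); rewrite mulf_eq0 orbb => /eqP.
Qed.

(* Modulo the rows orthogonal to v, v is congruent to A k, so that
   dot (A k) v = dot v v. *)
Lemma orthogonal_residue (R : realType) n (A : nat -> nat -> R) k
    (v c : nat -> R) :
  independent n A -> (k < n)%N ->
  (forall l, (l < k)%N -> dot n (A l) v = 0) ->
  (forall j, (j < n)%N -> v j = A k j + \sum_(m < k) c m * A m j) ->
  dot n (A k) v != 0.
Proof.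
move=> indep ltk ortho vE; apply/eqP => Akv0.
have vv0 : dot n v v = 0.
  transitivity (dot n (A k) v + \sum_(m < k) c m * dot n (A m) v); last first.
    by rewrite Akv0 add0r big1 // => m _; rewrite ortho ?mulr0.
  under [in RHS]eq_bigr do rewrite mulr_sumr.
  rewrite exchange_big -big_split /=; apply: eq_bigr => j _.
  rewrite {1}vE // mulrDl mulr_suml; congr (_ + _).
  by apply: eq_bigr => m _; rewrite mulrA.
(* Completing [c] by 1 at [k] and 0 beyond gives a combination of the rows equal to [v], which
   vanishes because its norm does. *)
pose c' m := if (m < k)%N then c m else (m == k)%:R.
suff /(_ k ltk) : forall m, (m < n)%N -> c' m = 0.
  by rewrite /c' ltnn eqxx => /eqP; rewrite oner_eq0.
apply: indep => j ltj; transitivity (v j); last exact: (dot_self_eq0 vv0 ltj).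
rewrite vE //.
rewrite -(big_mkord predT (fun m => c' m * A m j)) (big_cat_nat (n := k.+1)) //=.
have -> : \sum_(k.+1 <= m < n) c' m * A m j = 0.
  rewrite big_nat_cond; apply: big1 => m /andP[/andP[ltm _] _].
  by rewrite /c' ltnNge ltnW // (gtn_eqF ltm) mul0r.
rewrite addr0 big_nat_recr //= big_mkord {2}/c' ltnn eqxx mul1r addrC.
by congr (_ + _); apply: eq_bigr => m _; rewrite /c' ltn_ord.
Qed.

(** Sweeping a copy of row k with target 0 makes it orthogonal to the previous rows;
    [orthogonal_residue] then shows that the divisor stored for later sweeps is nonzero. *)
Lemma runs_gram_schmidt (R : realType) (s : state R) :
  let n := imem s 2 in
  let A l := rmem s 10 (imem s (20 + l)) in
  independent n A -> (forall l, rmem s 15 l 0 = 0) ->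
  runs gram_schmidt_prog s (n * (4 * n * n + 4 * n)) (fun s' =>
    frame [:: 9; 10; 11; 14] [:: 8; 12; 13] s s' /\
    forall l, (l < n)%N ->
      orthogonalized n A (rmem s' 12) (fun l => rmem s' 13 l 0) l).
Proof.
move=> n A indep z0.
apply: (@runs_for _ _ _ _ _ _ _ (fun k s' =>
    frame [:: 9; 10; 11; 14] [:: 8; 12; 13] s s' /\
    forall l, (l < k)%N ->
      orthogonalized n A (rmem s' 12) (fun l => rmem s' 13 l 0) l)) => //.
move=> k s' ltk [F gs]; rewrite /= in F *.
apply: (@runs_weaken _ _ _ (0 + (0 + (k * (4 * n + 2) + (0 + (2 * n + 0)))))); last 2 first.
- have : (k * (4 * n + 2) <= n * (4 * n + 2))%N by rewrite leq_mul2r (ltnW ltk) orbT.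
  lia.
- by move=> ?; exact.
apply: runs_step; set s1 := (exec _ _).1.
have F1 : frame [:: 9; 10; 11; 14] [:: 8; 12; 13] s s1.
  by case: F => F F'; frame_tac.
have k1 : imem s1 9 = k by [].
have n1 : imem s1 2 = n by rewrite F1.1.
have d1 : imem s1 14 = imem s (20 + k) by rewrite /s1 /= F.1.
have r1 : rmem s1 12 = rmem s' 12 by [].
have q1 : rmem s1 13 = rmem s' 13 by [].
clearbody s1.
have copy1 := @runs_copy _ 10 s1 isT; rewrite k1 n1 d1 (F1.2 10%N) // r1 in copy1.
apply: (runs_seq copy1) => {copy1} s2 [F2 other2 row2].
have k2 : imem s2 9 = k by rewrite F2.1.
have n2 : imem s2 2 = n by rewrite F2.1.
have A2 l : rmem s2 10 (imem s2 (20 + l)) = A l.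
  by rewrite F2.1 ?F1.1 ?F2.2 ?F1.2.
have gs2 l : (l < k)%N -> orthogonalized n A (rmem s2 12) (fun l => rmem s2 13 l 0) l.
  move=> ltl; have [] := gs l ltl; rewrite /orthogonalized (F2.2 13%N) // q1 other2 //.
  by rewrite neq_ltn ltl.
have sweep2 := @runs_sweep _ 15 s2 isT; rewrite /= k2 n2 (funext A2) in sweep2.
apply: (runs_seq (sweep2 gs2)) => {sweep2} s3 [F3 other3 fits3 [c cP]].
apply: runs_step; set s4 := (exec _ _).1.
have F34 : frame [:: 14] [::] s3 s4 by frame_tac.
have k4 : imem s4 9 = k by rewrite F34.1 // F3.1.
have d4 : imem s4 14 = imem s (20 + k).
  by rewrite /s4 /= (F3.1 9%N) // k2 F3.1 // F2.1 // F1.1.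
clearbody s4.
have F4 : frame [:: 9; 10; 11; 14] [:: 8; 12; 13] s s4.
  exact: (frame_trans (frame_trans (frame_trans F1 F2 isT isT) F3 isT isT) F34 isT isT).
have n4 : imem s4 2 = n by rewrite F4.1.
have dot4 := @runs_dot _ s4.
rewrite n4 k4 d4 (F34.2 12%N) // F4.2 // -/(A k) in dot4.
apply: (runs_seq dot4) => {dot4} s5 [F5 dot5]; split=> //=.
have row k' : rmem s5 12 k' = rmem s3 12 k' by rewrite F5.2 // F34.2.
have sq : rmem s5 13 = rmem s' 13 by rewrite F5.2 // F34.2 // F3.2 // F2.2.
split.
  have F45 := frame_trans F4 F5 isT isT.
  have [//|//|? ?] := @frame_sub _ _ _ [:: 9; 10; 11; 14] [:: 8; 12; 13] _ _ F45.
  by frame_tac.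
move=> l; rewrite ltnS leq_eqVlt => /orP[/eqP->|ltl].
  rewrite /orthogonalized /= F5.1 // k4 eqxx /= dot5 row.
  have vE j : (j < n)%N -> rmem s3 12 k j = A k j + \sum_(m < k) c m * A m j.
    move=> ltj; rewrite cP // row2 //; congr (_ + _).
    by apply: eq_bigr => m _; rewrite A2.
  have ortho l' : (l' < k)%N -> dot n (A l') (rmem s3 12 k) = 0.
    by move=> ltl; rewrite -(A2 l') fits3 // F2.2 // F1.2.
  split=> //; last by exists c.
  exact: orthogonal_residue vE.
have lNk : l != k by rewrite neq_ltn ltl.
have [] := gs l ltl; rewrite /orthogonalized /= F5.1 // k4 (negbTE lNk) /= sq row.
suff -> : rmem s3 12 l = rmem s' 12 l by [].
by apply/funext => j; rewrite other3 // other2.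
Qed.

(** * Decoding a tuple of indices and testing its injectivity *)

Local Notation digit_cell k := (NCell (NAdd (NConst 20) (ic k))).

(** With truncated subtraction, [(a - b) + (b - a)] is the distance between a and b. Cell 8
    accumulates the product of all pairwise distances, which is positive exactly when the indices
    are distinct. *)
Definition digits_prog : cmd :=
  NSet (NConst 13) (ic 5) ;;
  NSet (NConst 8) (NConst 1) ;;
  For (NConst 9) (ic 2)
    (NSet (NAdd (NConst 20) (ic 9)) (NMod (ic 13) (ic 1)) ;;
     NSet (NConst 13) (NDiv (ic 13) (ic 1)) ;;
     For (NConst 10) (ic 9)
       (NSet (NConst 8) (NMul (ic 8)
          (NAdd (NSub (digit_cell 9) (digit_cell 10))
                (NSub (digit_cell 10) (digit_cell 9)))))).

Definition digit (b t k : nat) : nat := ((t %/ b ^ k) %% b)%N.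

Definition distinct_below (f : nat -> nat) (n : nat) : Prop :=
  forall k l, (l < k < n)%N -> f k <> f l.

Lemma runs_digits (R : realType) (s : state R) :
  let n := imem s 2 in let f := digit (imem s 1) (imem s 5) in
  runs digits_prog s 0 (fun s' =>
    [/\ forall k, (k < 20)%N -> k \notin [:: 8; 9; 10; 13]%N ->
          imem s' k = imem s k,
        rmem s' = rmem s,
        forall k, (k < n)%N -> imem s' (20 + k) = f k &
        (0 < imem s' 8)%N <-> distinct_below f n]).
Proof.
move=> n f.
(* After k rounds cell 13 holds the code divided by [b ^ k], whose remainder modulo b is the next
   digit. Cells [20 + k] are written at computed addresses, so the unchanged cells are described
   here without [frame]. *)
pose I k s' := [/\ forall k, (k < 20)%N -> k \notin [:: 8; 9; 10; 13]%N ->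
          imem s' k = imem s k,
        rmem s' = rmem s, imem s' 13 = (imem s 5 %/ imem s 1 ^ k)%N,
        forall l, (l < k)%N -> imem s' (20 + l) = f l &
        (0 < imem s' 8)%N <-> distinct_below f k].
apply: (@runs_weaken _ _ _ (0 + (0 + n * (0 + (0 + n * 0))))); last 2 first.
- by rewrite !muln0.
- by move=> s'; exact.
do 2 apply: runs_step.
apply: (@runs_weaken _ _ _ (n * (0 + (0 + n * 0))) _ (I n)) => //; last first.
  by move=> s' [? ? _ ? ?].
apply: runs_for => //.
  split=> //=.
  - by move=> k ltk; rewrite !inE !negb_or => /and4P[/negbTE -> _ _ /negbTE ->].
  - by rewrite expn0 divn1.
  - by split=> // _ k l /andP[].
move=> k s' ltk [F Fr quo dig dist].
do 2 apply: runs_step; set s1 := (exec _ _).1.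
have F1 m : (m < 20)%N -> m \notin [:: 8; 9; 10; 13]%N -> imem s1 m = imem s m.
  move=> ltm; rewrite !inE !negb_or => /and4P[m8 m9 m10 m13].
  rewrite /s1 /= (negbTE m9) (negbTE m13); case: eqP => [mE|_].
    by move: ltm; rewrite mE.
  by rewrite F // !inE !negb_or m8 m9 m10.
have Fr1 : rmem s1 = rmem s by [].
have quo1 : imem s1 13 = (imem s 5 %/ imem s 1 ^ k.+1)%N.
  by rewrite /s1 /= quo F // expnSr divnMA.
have dig1 l : (l < k.+1)%N -> imem s1 (20 + l) = f l.
  rewrite ltnS leq_eqVlt /s1 /= eqn_add2l => /orP[/eqP->|ltl].
    by rewrite eqxx quo F.
  by rewrite (ltn_eqF ltl) dig.
have k1 : imem s1 9 = k by [].
have dist1 : imem s1 8 = imem s' 8 by [].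
clearbody s1.
apply: (@runs_weaken _ _ _ (k * 0)); last 2 first.
- by rewrite !muln0.
- by move=> s2; exact.
apply: (@runs_weaken _ _ _ (k * 0) _ (fun s2 =>
    [/\ forall m, (m < 20)%N -> m \notin [:: 8; 10]%N ->
          imem s2 m = imem s1 m,
        rmem s2 = rmem s1,
        forall l, (l < k.+1)%N -> imem s2 (20 + l) = f l &
        (0 < imem s2 8)%N <->
          distinct_below f k /\ forall l, (l < k)%N -> f k <> f l])) => //.
  apply: (@runs_for _ _ _ _ _ _ _ (fun m s2 =>
    [/\ forall m, (m < 20)%N -> m \notin [:: 8; 10]%N ->
          imem s2 m = imem s1 m,
        rmem s2 = rmem s1,
        forall l, (l < k.+1)%N -> imem s2 (20 + l) = f l &
        (0 < imem s2 8)%N <->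
          distinct_below f k /\ forall l, (l < m)%N -> f k <> f l])) => //.
    by split=> //; rewrite dist1 dist; split=> [|[]].
  move=> m s2 ltm [F2 Fr2 dig2 dist2]; split=> //=; split=> //=.
  - move=> p ltp; rewrite !inE negb_or => /andP[p8 p10].
    by rewrite (negbTE p8) (negbTE p10) F2 // !inE negb_or p8.
  - rewrite (F2 9%N) // k1.
    rewrite !dig2 //; last by rewrite ltnS ltnW.
    rewrite muln_gt0; split=> [/andP[/dist2[d dk] fkm]|[d dk]].
      split=> // l; rewrite ltnS leq_eqVlt => /orP[/eqP-> e|]; last exact: dk.
      by rewrite e subnn in fkm.
    apply/andP; split; first by apply/dist2; split=> // l ltl; apply/dk/ltnW.
    by have := dk m (ltnSn m); lia.
move=> s2 [F2 Fr2 dig2 dist2]; split=> //.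
- move=> m ltm; rewrite !inE !negb_or => /and4P[m8 m9 m10 m13].
  rewrite F2 //; last by rewrite !inE negb_or m8.
  by rewrite F1 // !inE !negb_or m8 m9 m10.
- by rewrite Fr2.
- by rewrite F2.
- rewrite dist2; split=> [[d dk] k' l /andP[ltl]|d].
    by rewrite ltnS leq_eqVlt => /orP[/eqP e|lt]; [rewrite e in ltl *; exact: dk|
      apply: d; rewrite ltl].
  split=> [k' l /andP[ltl lt]|l ltl]; apply: d; first by rewrite ltl ltnW.
  by rewrite ltl ltnSn.
Qed.

(** * Solving for the interpolating affine function *)

Definition solve_prog : cmd :=
  NSet (NConst 13) (ic 6) ;;
  For (NConst 9) (ic 2)
    (IfN (NMod (ic 13) (NConst 2)) (NConst 0)
       (ROp RAdd (loc 14 (ic 9) (NConst 0)) (loc 1 (digit_cell 9) (NConst 0))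
          (loc 2 (NConst 0) (NConst 0)))
       (ROp RSub (loc 14 (ic 9) (NConst 0)) (loc 1 (digit_cell 9) (NConst 0))
          (loc 2 (NConst 0) (NConst 0))) ;;
     NSet (NConst 13) (NDiv (ic 13) (NConst 2))) ;;
  NSet (NConst 9) (ic 2) ;;
  NSet (NConst 14) (NConst 0) ;;
  copy_prog 15 ;;
  sweep_prog 14.

Definition perturbation (R : realType) (eps : R) (q k : nat) : R :=
  if digit 2 q k == 0%N then eps else - eps.

(** The solution is built from 0 in row n of array 12, just after the n residues, which thus survive
    for the next sign pattern. The n operations outside the sweep form the perturbed right-hand
    side. *)
Lemma runs_solve (R : realType) (s : state R) :
  let n := imem s 2 in
  let A l := rmem s 10 (imem s (20 + l)) in
  (forall j, rmem s 15 0 j = 0) ->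
  (forall l, (l < n)%N -> 
     orthogonalized n A (rmem s 12) (fun l => rmem s 13 l 0) l) ->
  runs solve_prog s (n + n * (4 * n + 2)) (fun s' =>
    [/\ frame [:: 9; 10; 11; 13; 14] [:: 8; 12; 14] s s', imem s' 9 = n,
        forall i, i != n -> rmem s' 12 i = rmem s 12 i &
        forall l, (l < n)%N -> dot n (A l) (rmem s' 12 n) =
          rmem s 1 (imem s (20 + l)) 0 +
          perturbation (rmem s 2 0 0) (imem s 6) l]).
Proof.
move=> n A z0 gs.
apply: (@runs_weaken _ _ _ (0 + (n * 1 + (0 + (0 + (0 + n * (4 * n + 2))))))); last 2 first.
- by rewrite muln1 !add0n.
- by move=> s'; exact.
apply: runs_step.
apply: (@runs_seq _ _ _ _ _ _ (fun s1 => frame [:: 9; 13] [:: 14] s s1 /\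
   forall l, (l < n)%N -> rmem s1 14 l 0 =
     rmem s 1 (imem s (20 + l)) 0 + perturbation (rmem s 2 0 0) (imem s 6) l)).
  (* The loop invariant must also track cell 13: the sign code divided by [2 ^ k], whose parity
     selects the k-th sign. *)
  apply: (@runs_weaken _ _ _ (n * 1) _ (fun s1 => [/\ frame [:: 9; 13] [:: 14] s s1,
    imem s1 13 = (imem s 6 %/ 2 ^ n)%N &
    forall l, (l < n)%N -> rmem s1 14 l 0 =
     rmem s 1 (imem s (20 + l)) 0 + perturbation (rmem s 2 0 0) (imem s 6) l])) => //.
    apply: (@runs_for _ _ _ _ _ _ _ (fun k s1 => [/\ frame [:: 9; 13] [:: 14] s s1,
    imem s1 13 = (imem s 6 %/ 2 ^ k)%N &
    forall l, (l < k)%N -> rmem s1 14 l 0 =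
     rmem s 1 (imem s (20 + l)) 0 + perturbation (rmem s 2 0 0) (imem s 6) l])) => //=.
      split=> //; last by rewrite expn0 divn1.
      frame_tac.
    move=> k s1 ltk [F quo row].
    have F' := F; case: F' => Fi Fr.
    rewrite /runs /= leqn0 quo -/(digit 2 (imem s 6) k).
    split; last by case: ifP.
    split.
    - case: ifP => _ /=; frame_tac.
    - by case: ifP => _ /=; rewrite quo expnSr divnMA.
    - move=> l; rewrite ltnS leq_eqVlt => /orP[/eqP->|ltl]; last first.
        by rewrite -row //; case: ifP => _ /=; rewrite (ltn_eqF ltl).
      rewrite /perturbation.
      by case: ifP => _ /=; rewrite eqxx /= !Fi // !Fr.
  by move=> s1 [].
move=> s1 [F1 w1]; do 2 apply: runs_step.
set s2 := (exec _ _).1.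
have F2 : frame [:: 9; 13; 14] [:: 14] s s2.
  by have [//|//|? ?] := @frame_sub _ _ _ [:: 9; 13; 14] [:: 14] _ _ F1; frame_tac.
have n2 : imem s2 2 = n by rewrite F2.1.
have k2 : imem s2 9 = n by rewrite /s2 /= F1.1.
have d2 : imem s2 14 = 0%N by [].
have w2 : rmem s2 14 = rmem s1 14 by [].
clearbody s2.
have copy2 := @runs_copy _ 15 s2 isT.
rewrite n2 k2 d2 (F2.2 15%N) // (F2.2 12%N) // in copy2.
apply: (runs_seq copy2) => {copy2} s3 [F3 other3 row3].
have n3 : imem s3 2 = n by rewrite F3.1.
have k3 : imem s3 9 = n by rewrite F3.1.
have A3 l : rmem s3 10 (imem s3 (20 + l)) = A l.
  by rewrite F3.1 // F2.1 // F3.2 // F2.2.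
have gs3 l : (l < n)%N -> orthogonalized n A (rmem s3 12) (fun l => rmem s3 13 l 0) l.
  move=> ltl; have [] := gs l ltl.
  by rewrite /orthogonalized (F3.2 13%N) // (F2.2 13%N) // other3 // neq_ltn ltl.
have sweep3 := @runs_sweep _ 14 s3 isT; rewrite /= n3 k3 (funext A3) in sweep3.
apply: (runs_weaken (sweep3 gs3)) => {sweep3} // s4 [F4 other4 fits4 _].
split.
- have F0 := frame_refl [:: 9; 10; 11; 13; 14]%N [:: 8; 12; 14]%N s.
  have F03 := frame_trans (frame_trans F0 F2 isT isT) F3 isT isT.
  exact: (frame_trans F03 F4 isT isT).
- by rewrite F4.1.
- by move=> i iNn; apply/funext => j; rewrite other4 // other3.
- by move=> l ltl; rewrite -A3 fits4 // F3.2 // w2 w1.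
Qed.

(** * Updating the extrema of the functionals *)

Local Notation cell6 j := (loc 6 (ic 12) (NConst j)).

(** No real can serve as an infinite starting value, so cell 7 tells whether a candidate has been
    seen, and the first one is copied into both columns. Each functional costs a dot product and at
    most two comparisons. *)
Definition update_prog : cmd :=
  For (NConst 12) (NAdd (ic 1) (ic 2))
    (NSet (NConst 14) (ic 12) ;;
     dot_prog ;;
     IfN (NConst 1) (ic 7)
       (IfR acc (cell6 0) (RCopy (cell6 0) acc) Skip ;;
        IfR (cell6 1) acc (RCopy (cell6 1) acc) Skip)
       (RCopy (cell6 0) acc ;; RCopy (cell6 1) acc)) ;;
  NSet (NConst 7) (NConst 1).

Lemma runs_update (R : realType) (s : state R) :
  let n := imem s 2 in
  let v i := dot n (rmem s 10 i) (rmem s 12 (imem s 9)) in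
  runs update_prog s ((imem s 1 + n) * (2 * n + 2))%N (fun s' =>
    [/\ frame [:: 7; 11; 12; 14] [:: 6; 8] s s', imem s' 7 = 1%N &
        forall i, (i < imem s 1 + n)%N ->
          rmem s' 6 i 0 =
            (if (imem s 7 == 0)%N || (v i <= rmem s 6 i 0)
             then v i else rmem s 6 i 0) /\
          rmem s' 6 i 1 =
            (if (imem s 7 == 0)%N || (rmem s 6 i 1 <= v i)
             then v i else rmem s 6 i 1)]).
Proof.
move=> n v; set m := (_ + n)%N.
pose lo i := if (imem s 7 == 0)%N || (v i <= rmem s 6 i 0)
             then v i else rmem s 6 i 0%N.
pose hi i := if (imem s 7 == 0)%N || (rmem s 6 i 1%N <= v i)
             then v i else rmem s 6 i 1%N.
pose I k s' := [/\ frame [:: 11; 12; 14] [:: 6; 8] s s',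
   forall i, (i < k)%N -> rmem s' 6 i 0 = lo i /\ rmem s' 6 i 1 = hi i &
   forall i j, (k <= i)%N -> rmem s' 6 i j = rmem s 6 i j].
rewrite -[(m * _)%N]addn0; apply: (@runs_seq _ _ _ _ _ _ (I m)); last first.
  move=> s1 [F done1 _]; split=> //=; split=> //.
  by have [//|//|? ?] := @frame_sub _ _ _ [:: 7; 11; 12; 14] [:: 6; 8] _ _ F; frame_tac.
apply: runs_for => // i s' lti [F done_i rest].
have -> : (2 * n + 2 = 0 + (2 * n + 2))%N by [].
apply: runs_step; set s1 := (exec _ _).1.
have F1 : frame [:: 11; 12; 14] [:: 6; 8] s s1 by case: F => ? ?; frame_tac.
have n1 : imem s1 2 = n by rewrite F1.1.
have i1 : imem s1 12 = i by [].
have d1 : imem s1 14 = i by [].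
have r1 : rmem s1 6 = rmem s' 6 by [].
clearbody s1.
have dot1 := @runs_dot _ s1.
rewrite n1 d1 (F1.1 9%N) // (F1.2 10%N) // (F1.2 12%N) // -/(v i) in dot1.
apply: (runs_seq dot1) => {dot1} s2 [F2 dot2].
have F12 := frame_trans F1 F2 isT isT.
have [Fi Fr] := F12.
have i2 : imem s2 12 = i by rewrite F2.1.
have row2 j : rmem s2 6 i j = rmem s 6 i j by rewrite F2.2 // r1 rest.
have row2N i' j : rmem s2 6 i' j = rmem s' 6 i' j by rewrite F2.2 // r1.
apply: (@runs_weaken _ _ _ 2 _ (fun s3 => [/\ frame [::] [:: 6] s2 s3,
  rmem s3 6 i 0 = lo i, rmem s3 6 i 1 = hi i &
  forall i' j, i' != i -> rmem s3 6 i' j = rmem s2 6 i' j])) => //.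
  rewrite /runs /= i2 dot2 !row2 (Fi 7%N) // lt0n /lo /hi.
  case: (imem s 7 == 0%N) => /=; [|case: (v i <= _);
    rewrite /= ?i2 ?eqxx /= ?row2 ?dot2; case: (_ <= v i)];
  (split=> //; split=> [|||i' j /negbTE i'N] /=;
    first [by frame_tac | by rewrite ?i2 ?eqxx ?i'N /= ?row2 ?dot2]).
move=> s3 [F3 lo3 hi3 other3]; split.
- exact: (frame_trans F12 F3).
- move=> i'; rewrite ltnS leq_eqVlt => /orP[/eqP-> //|lti'].
  by rewrite !other3 ?(ltn_eqF lti') // !row2N; exact: done_i.
- by move=> i' j lti'; rewrite other3 ?gtn_eqF // row2N rest // ltnW.
Qed.

(** * The loop over tuples and sign patterns *)

Definition main_prog : cmd :=
  For (NConst 5) (ic 3)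
    (digits_prog ;;
     IfN (NConst 1) (ic 8)
       (gram_schmidt_prog ;; For (NConst 6) (ic 4) (solve_prog ;; update_prog))
       Skip).

(** [W] stands for the solutions met so far: as long as the flag in cell 7 is 0, nothing is claimed
    about array 6 and [W] is empty. *)
Definition extrema (R : realType) (n m : nat) (E : nat -> nat -> R)
    (W : set (nat -> R)) (s : state R) : Prop :=
  if imem s 7 == 0%N then W = set0 else
  forall i, (i < m)%N ->
    is_min [set dot n (E i) y | y in W] (rmem s 6 i 0%N) /\
    is_max [set dot n (E i) y | y in W] (rmem s 6 i 1%N).

Lemma is_min_insert (R : realType) (E : set R) m v :
  is_min E m -> is_min (E `|` [set v]) (if v <= m then v else m).
Proof.
move=> [Em lbm]; case: (leP v m) => [le_vm|lt_mv]; split.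
- by right.
- by move=> u [/lbm|->] //; exact: le_trans.
- by left.
- by move=> u [/lbm|->] //; exact: ltW.
Qed.

Lemma is_max_insert (R : realType) (E : set R) m v :
  is_max E m -> is_max (E `|` [set v]) (if m <= v then v else m).
Proof.
move=> [Em ubm]; case: (leP m v) => [le_mv|lt_vm]; split.
- by right.
- by move=> u [/ubm|->] // /le_trans; exact.
- by left.
- by move=> u [/ubm|->] //; exact: ltW.
Qed.

Lemma runs_ifn (R : realType) e1 e2 c1 c2 (s : state R) T (Q : state R -> Prop) :
  (if (neval (imem s) e1 <= neval (imem s) e2)%N
   then runs c1 s T Q else runs c2 s T Q) -> runs (IfN e1 e2 c1 c2) s T Q.
Proof. by rewrite /runs /=; case: ifP. Qed.

(** [C] is a class of functions that no functional distinguishes from the computed [y0]. Adding the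
    whole class to [W] therefore inserts a single value into each image. *)
Lemma runs_extrema (R : realType) (W C : set (nat -> R)) (s : state R) :
  let n := imem s 2 in let m := (imem s 1 + n)%N in
  let E := rmem s 10 in let y0 := rmem s 12 (imem s 9) in
  extrema n m E W s -> C y0 ->
  (forall y, C y -> forall i, dot n (E i) y = dot n (E i) y0) ->
  runs update_prog s (m * (2 * n + 2)) (fun s' =>
    frame [:: 7; 11; 12; 14] [:: 6; 8] s s' /\ extrema n m E (W `|` C) s').
Proof.
move=> n m E y0 extW Cy0 C1.
apply: (runs_weaken (runs_update s)) => // s' [F flag' upd]; split=> //.
rewrite /extrema flag' /= => i lti; rewrite image_setU.
have -> : [set dot n (E i) y | y in C] = [set dot n (E i) y0].
  by apply/seteqP; split=> [_ [y Cy <-] | _ ->] /=; [exact: C1|exists y0].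
have [-> ->] := upd i lti.
move: extW; rewrite /extrema; case: (imem s 7 == 0%N) => [->|extW] /=.
  by rewrite image_set0 set0U; split; split=> // _ ->.
by have [mi ma] := extW i lti; split; [exact: is_min_insert|exact: is_max_insert].
Qed.

Lemma independent_unitmx (R : realType) n (A : nat -> nat -> R) :
  independent n A -> (\matrix_(l < n, j < n) A l j) \in unitmx.
Proof.
move=> indep; rewrite -row_free_unit; apply: inj_row_free => c cM0.
pose c' m := if insub m is Some m' then c 0 m' else 0.
have c'E m : (m < n)%N -> c' m = 0.
  apply: indep => k ltk; have /rowP/(_ (Ordinal ltk)) := cM0.
  rewrite !mxE => cM0k; rewrite -[RHS]cM0k; apply: eq_bigr => m' _.
  by rewrite !mxE /c' valK.
by apply/rowP => m'; rewrite mxE -(c'E m') // /c' valK.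
Qed.

(** The matrix of rows is invertible and kills the difference of [u] and [v]. This gives uniqueness
    of the interpolant for a tuple and a sign pattern. *)
Lemma independent_dot_inj (R : realType) n (A : nat -> nat -> R) (u v : nat -> R) :
  independent n A -> (forall l, (l < n)%N -> dot n (A l) u = dot n (A l) v) ->
  forall j, (j < n)%N -> u j = v j.
Proof.
move=> indep eq_uv j ltj.
have unitM := independent_unitmx indep; set M := (\matrix_(_, _) _) in unitM.
pose w : 'cV[R]_n := \col_k (u k - v k).
suff /colP/(_ (Ordinal ltj)) : w = 0 by rewrite !mxE => /eqP; rewrite subr_eq0 => /eqP.
rewrite -[w](mulKmx unitM); suff -> : M *m w = 0 by rewrite mulmx0.
apply/colP => l; rewrite !mxE.
transitivity (dot n (A l) u - dot n (A l) v); last by rewrite eq_uv ?subrr.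
by rewrite /dot -sumrB; apply: eq_bigr => k _; rewrite !mxE mulrBr.
Qed.

(** Entries of [y] from [n] on are free, so even for independent rows this is a class of functions,
    all equal below [n]. *)
Definition candidate (R : realType) (n b : nat) (E : nat -> nat -> R)
    (Z : nat -> R) (eps : R) (t q : nat) : set (nat -> R) :=
  [set y | forall l, (l < n)%N -> 
     dot n (E (digit b t l)) y = Z (digit b t l) + perturbation eps q l].

Definition visited (R : realType) (n b : nat) (E : nat -> nat -> R)
    (Z : nat -> R) (eps : R) (t : nat) : set (nat -> R) :=
  [set y | exists t' q, [/\ (t' < t)%N, distinct_below (digit b t') n,
     (q < 2 ^ n)%N & candidate n b E Z eps t' q y]].

Lemma runs_main (R : realType) (s : state R) :
  let n := imem s 2 in let b := imem s 1 in let m := (b + n)%N in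
  let E := rmem s 10 in let Z i := rmem s 1 i 0%N in let eps := rmem s 2 0 0 in
  imem s 4 = (2 ^ n)%N -> imem s 7 = 0%N -> (forall i j, rmem s 15 i j = 0) ->
  (forall t, distinct_below (digit b t) n ->
     independent n (fun l => E (digit b t l))) ->
  runs main_prog s
    (imem s 3 * (n * (4 * n * n + 4 * n) +
       2 ^ n * (n + n * (4 * n + 2) + m * (2 * n + 2))))
    (fun s' => [/\ forall k, (k < 5)%N -> imem s' k = imem s k,
       forall a, a \notin [:: 6; 8; 12; 13; 14]%N -> rmem s' a = rmem s a &
       extrema n m E (visited n b E Z eps (imem s 3)) s']).
Proof.
move=> n b m E Z eps s4 s7 z0 indep.
apply: (@runs_for _ _ _ _ _ _ _ (fun t s' =>
    [/\ forall k, (k < 5)%N -> imem s' k = imem s k,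
       forall a, a \notin [:: 6; 8; 12; 13; 14]%N -> rmem s' a = rmem s a &
       extrema n m E (visited n b E Z eps t) s'])) => //.
  split=> //; rewrite /extrema s7 /=.
  by apply/seteqP; split=> // y [t' [q []]].
move=> t s' ltt [Fi Fr ext].
rewrite -[(_ + 2 ^ n * _)%N]add0n.
have digs := @runs_digits _ (set_int s' 5 t).
rewrite /= !Fi // -/n -/b in digs.
apply: (runs_seq digs) => {digs} s1 [F1 r1 dig1 dist1].
have Fi1 k : (k < 5)%N -> imem s1 k = imem s k.
  move=> ltk; have kin : k \notin [:: 8; 9; 10; 13]%N.
    by move: k ltk; do 5?case=> //.
  by rewrite F1 //; [move: k ltk {kin}; do 5?case=> //=; rewrite Fi|lia].
have Fr1 a : a \notin [:: 6; 8; 12; 13; 14]%N -> rmem s1 a = rmem s a.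
  by move=> aN; rewrite r1 Fr.
have s17 : imem s1 7 = imem s' 7 by rewrite F1.
have ext1 : extrema n m E (visited n b E Z eps t) s1.
  by move: ext; rewrite /extrema s17 r1.
clear F1 r1 s17 ext Fi Fr s'.
(* A tuple with a repetition contributes nothing to [visited], so skipping it preserves the
   invariant. *)
apply: runs_ifn => /=; case: ifP => [pos|neg]; last first.
  split=> //; split=> //.
  suff -> : visited n b E Z eps t.+1 = visited n b E Z eps t by [].
  apply/seteqP; split=> y [t' [q [ltt' dist ltq cand]]]; exists t', q;
    split=> //; last exact: ltnW.
  move: ltt' dist; rewrite ltnS leq_eqVlt => /orP[/eqP->|//].
  by move=> /dist1; rewrite neg.
move/dist1: pos => dist {dist1}.
have A1 l : (l < n)%N -> rmem s1 10 (imem s1 (20 + l)) = E (digit b t l).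
  by move=> ltl; rewrite Fr1 // dig1.
have n1 : imem s1 2 = n by rewrite Fi1.
have indep1 : independent n (fun l => rmem s1 10 (imem s1 (20 + l))).
  move=> c c0; apply: (indep t dist) => j ltj; rewrite -[RHS](c0 j ltj).
  by apply: eq_bigr => l _; rewrite A1.
have gs1 := @runs_gram_schmidt _ s1; rewrite n1 in gs1.
apply: (runs_seq (gs1 indep1 _)) => {gs1} [l|s2 [F2 gs2]]; first by rewrite Fr1.
(* [C q] gathers the solutions for tuple t and sign codes below q. The inner invariant also keeps
   the residues in rows below n, which every solve reuses. *)
pose C q := [set y : nat -> R | exists2 q', (q' < q)%N & candidate n b E Z eps t q' y].
pose I q s3 := [/\ frame [:: 6; 7; 9; 10; 11; 12; 13; 14] [:: 6; 8; 12; 14] s2 s3,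
  forall l, (l < n)%N -> rmem s3 12 l = rmem s2 12 l &
  extrema n m E (visited n b E Z eps t `|` C q) s3].
have n2 : imem s2 2 = n by rewrite F2.1.
have c4 : imem s2 4 = (2 ^ n)%N by rewrite F2.1 // Fi1.
apply: (@runs_weaken _ _ _ (2 ^ n * (n + n * (4 * n + 2) + m * (2 * n + 2)))
  _ (I (2 ^ n)%N)) => //; last first.
  move=> s3 [F3 _ ext3].
  have F2' := frame_sub F2 (ks' := [:: 6; 7; 9; 10; 11; 12; 13; 14]%N)
    (arrs' := [:: 6; 8; 12; 13; 14]%N) isT isT.
  have F23 := frame_trans F2' F3 isT isT.
  split.
  - move=> k ltk; rewrite F23.1 ?Fi1 //.
    by move: k ltk; do 5?case=> //.
  - by move=> a aN; rewrite F23.2 // Fr1.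
  suff -> : visited n b E Z eps t.+1 = visited n b E Z eps t `|` C (2 ^ n)%N by [].
  apply/seteqP; split=> y.
    move=> [t' [q [ltt' dist' ltq cand]]].
    move: ltt' dist' cand; rewrite ltnS leq_eqVlt => /orP[/eqP->|lt' dist' cand].
      by move=> _ cand; right; exists q.
    by left; exists t', q.
  move=> [[t' [q [ltt' dist' ltq cand]]]|[q ltq cand]].
    by exists t', q; split=> //; exact: ltnW.
  by exists t, q.
apply: runs_for => //.
  split=> //; rewrite [C _](_ : _ = set0) ?setU0.
    by move: ext1; rewrite /extrema F2.1 // F2.2.
  by apply/seteqP; split=> // y [].
move=> q s3 ltq [F3 row3 ext3].
set s4' := set_int _ _ _.
have [//|//|Fi3 Fr3] := frame_sub F3 (arrs' := [:: 6; 8; 12; 14]%N)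
  (ks' := [:: 6; 7; 9; 10; 11; 12; 13; 14]%N).
have F4 : frame [:: 6; 7; 9; 10; 11; 12; 13; 14] [:: 6; 8; 12; 14] s2 s4' by frame_tac.
have q4 : imem s4' 6 = q by [].
have row4 : rmem s4' 12 = rmem s3 12 by [].
have ext4 : extrema n m E (visited n b E Z eps t `|` C q) s4' by [].
clearbody s4'.
have n4 : imem s4' 2 = n by rewrite F4.1.
have A4 l : (l < n)%N -> rmem s4' 10 (imem s4' (20 + l)) = E (digit b t l).
  by move=> ltl; rewrite F4.2 // F2.2 // -A1 // F4.1 // F2.1.
have A4' l : rmem s4' 10 (imem s4' (20 + l)) = rmem s1 10 (imem s1 (20 + l)).
  by rewrite F4.2 // F2.2 // F4.1 // F2.1.
have solve4 := @runs_solve _ s4'.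
rewrite /= n4 q4 (funext A4') in solve4.
apply: (runs_seq (solve4 _ _)) => {solve4}.
- by move=> j; rewrite F4.2 // F2.2 // Fr1.
- move=> l ltl; have [] := gs2 l ltl.
  by rewrite /orthogonalized row4 row3 // (F4.2 13%N).
move=> s5 [F5 k5 other5 sol5].
have F45 := frame_trans F4 F5 isT isT.
have n5 : imem s5 2 = n by rewrite F5.1.
have b5 : imem s5 1 = b by rewrite F45.1 // F2.1 // Fi1.
have E5 : rmem s5 10 = E by rewrite F45.2 // F2.2 // Fr1.
have ext5 : extrema n m E (visited n b E Z eps t `|` C q) s5.
  by move: ext4; rewrite /extrema !F5.1 // !F5.2.
have cand5 : candidate n b E Z eps t q (rmem s5 12 n).
  move=> l ltl; have := sol5 l ltl; rewrite A4 // => ->.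
  rewrite (F4.2 1%N) // (F2.2 1%N) // (Fr1 1%N) //.
  rewrite (F4.2 2%N) // (F2.2 2%N) // (Fr1 2%N) //.
  by rewrite F4.1 // F2.1 // dig1.
have ext6 := @runs_extrema _ (visited n b E Z eps t `|` C q)
  (candidate n b E Z eps t q) s5.
rewrite /= n5 b5 E5 k5 in ext6.
apply: (runs_weaken (ext6 ext5 cand5 _)) => {ext6} //.
  move=> y candy i; apply: eq_dot; apply: (independent_dot_inj (indep t dist)).
  by move=> l ltl; rewrite candy // cand5.
move=> s6 [F6 ext6]; split.
- exact: (frame_trans F45 F6 isT isT).
- move=> l ltl; rewrite F6.2 // other5 ?row4 ?row3 //.
  by rewrite neq_ltn ltl.
- move: ext6; rewrite -setUA; suff -> : C q `|` candidate n b E Z eps t q = C q.+1 by [].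
  apply/seteqP; split=> y.
    by move=> [[q' ltq' ?]|?]; [exists q' => //; exact: ltnW|exists q].
  move=> [q']; rewrite ltnS leq_eqVlt => /orP[/eqP->|ltq'] ?; first by right.
  by left; exists q'.
Qed.

(** * Initialisation of the counters and of the functionals *)

Definition init_prog : cmd :=
  NSet (NConst 2) (NAdd (ic 0) (NConst 1)) ;;
  NSet (NConst 3) (NConst 1) ;;
  NSet (NConst 4) (NConst 1) ;;
  For (NConst 9) (ic 2)
    (NSet (NConst 3) (NMul (ic 3) (ic 1)) ;;
     NSet (NConst 4) (NMul (ic 4) (NConst 2))) ;;
  For (NConst 12) (ic 1)
    (For (NConst 11) (ic 0)
       (RCopy (loc 10 (ic 12) (ic 11)) (loc 0 (ic 12) (ic 11))) ;;
     RConst (loc 10 (ic 12) (ic 0)) true) ;;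
  For (NConst 12) (ic 2) (RConst (loc 10 (NAdd (ic 1) (ic 12)) (ic 12)) true).

(* Against y = (a, b), row i < N evaluates at x_i, row N + r is the partial
   derivative a_r, and row N + d is the value b at 0. *)
Definition functional_rows (R : realType) (d b : nat) (X : nat -> nat -> R)
    (i j : nat) : R :=
  if (i < b)%N then if (j < d)%N then X i j else (j == d)%:R
  else if (i < b + d.+1)%N then (b + j == i)%:R else 0.

(** Only integer operations, copies and constants occur, hence the zero cost. The zero entries of
    the unit rows are not written: they come from the initial zeros of array 10. *)
Lemma runs_init (R : realType) (s : state R) :
  let d := imem s 0 in let b := imem s 1 in
  (forall i j, rmem s 10 i j = 0) ->
  runs init_prog s 0 (fun s' =>
    [/\ frame [:: 2; 3; 4; 9; 11; 12] [:: 10] s s',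
        imem s' 2 = d.+1, imem s' 3 = (b ^ d.+1)%N, imem s' 4 = (2 ^ d.+1)%N &
        rmem s' 10 = functional_rows d b (rmem s 0)]).
Proof.
move=> d b z10.
apply: (@runs_weaken _ _ _ (0 + (0 + (0 + (d.+1 * 0 + (b * (d * 0 + 0) + d.+1 * 0)))))); last 2 first.
- by rewrite !(muln0, addn0).
- by move=> s'; exact.
do 3 apply: runs_step; set s1 := (exec _ _).1.
have F1 : frame [:: 2; 3; 4; 9; 11; 12] [:: 10] s s1 by frame_tac.
have d1 : imem s1 2 = d.+1 by rewrite /s1 /= addn1.
have p1 : imem s1 3 = 1%N by [].
have q1 : imem s1 4 = 1%N by [].
have r1 : rmem s1 = rmem s by [].
clearbody s1.
apply: (@runs_seq _ _ _ _ _ _ (fun s2 => [/\ frame [:: 3; 4; 9] [::] s1 s2,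
   imem s2 3 = (b ^ d.+1)%N & imem s2 4 = (2 ^ d.+1)%N])).
  apply: (@runs_for _ _ _ _ _ _ _ (fun k s2 => [/\ frame [:: 3; 4; 9] [::] s1 s2,
   imem s2 3 = (b ^ k)%N & imem s2 4 = (2 ^ k)%N])) => //.
  move=> k s2 _ [F2 p2 q2]; split=> //=; split=> /=.
  - by case: F2 => ? ?; frame_tac.
  - by rewrite p2 F2.1 // F1.1 // expnSr.
  - by rewrite q2 expnSr.
move=> s2 [F2 p2 q2].
have F12 := frame_trans F1 F2 isT isT.
have z2 i j : rmem s2 10 i j = 0 by rewrite F2.2 // r1.
apply: (@runs_seq _ _ _ _ _ _ (fun s3 => [/\ frame [:: 11; 12] [:: 10] s2 s3 &
   forall i j, rmem s3 10 i j =
     if (i < b)%N then if (j < d)%N then rmem s 0 i j else (j == d)%:R else 0])).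
  apply: (@runs_for _ _ _ _ _ _ _ (fun k s3 => [/\ frame [:: 11; 12] [:: 10] s2 s3 &
   forall i j, rmem s3 10 i j =
     if (i < k)%N then if (j < d)%N then rmem s 0 i j else (j == d)%:R else 0])) => //.
    by rewrite /= F12.1.
  move=> k s3 ltk [F3 row3].
  apply: (@runs_seq _ _ _ _ _ _ (fun s4 => [/\ frame [:: 11; 12] [:: 10] s2 s4,
    imem s4 12 = k &
   forall i j, rmem s4 10 i j = if (i == k) && (j < d)%N then rmem s 0 k j
     else rmem s3 10 i j])).
    apply: (@runs_for _ _ _ _ _ _ _ (fun l s4 => [/\ frame [:: 11; 12] [:: 10] s2 s4,
    imem s4 12 = k &
    forall i j, rmem s4 10 i j = if (i == k) && (j < l)%N then rmem s 0 k j
      else rmem s3 10 i j])) => //.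
    - by rewrite /= F3.1 // F12.1.
    - split=> //; first by case: F3 => ? ?; frame_tac.
      by move=> i j; rewrite andbF.
    - move=> l s4 ltl [F4 k4 row4]; split=> //=; split=> //=.
        by case: F4 => ? ?; frame_tac.
      move=> i j; rewrite k4 F4.2 // F2.2 // r1 row4 ltnS [(j <= l)%N]leq_eqVlt.
      by do 2 case: eqP => [->|_] //=.
  move=> s4 [F4 k4 row4]; split=> //=; split=> [|i j] /=.
    by case: F4 => ? ?; frame_tac.
  rewrite k4 F4.1 // F12.1 // -/d row4 row3 ltnS [(i <= k)%N]leq_eqVlt.
  case: eqP => [->|_] /=; rewrite ?ltnn /= //.
  by case: ltngtP.
move=> s3 [F3 row3].
have F13 := frame_trans F12 F3 isT isT.
apply: (@runs_weaken _ _ _ (d.+1 * 0) _ (fun s4 => [/\ frame [:: 12] [:: 10] s3 s4 &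
   forall i j, rmem s4 10 i j = if (i < b)%N then rmem s3 10 i j
     else if (i < b + d.+1)%N then (b + j == i)%:R else 0])) => //; last first.
  move=> s4 [F4 row4]; split.
  - exact: (frame_trans F13 F4).
  - by rewrite F4.1 // F3.1 // F2.1.
  - by rewrite F4.1 // F3.1.
  - by rewrite F4.1 // F3.1.
  - apply/funext => i; apply/funext => j; rewrite row4 /functional_rows row3.
    by case: (i < b)%N.
apply: (@runs_for _ _ _ _ _ _ _ (fun k s4 => [/\ frame [:: 12] [:: 10] s3 s4 &
   forall i j, rmem s4 10 i j = if (i < b)%N then rmem s3 10 i j
     else if (i < b + k)%N then (b + j == i)%:R else 0])) => //.
- by rewrite /= F3.1 // F2.1.
- by split=> // i j; rewrite addn0 row3; case: (i < b)%N.
- move=> k s4 ltk [F4 row4]; split=> //=; split=> //=.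
    by case: F4 => ? ?; frame_tac.
  move=> i j; rewrite F4.1 // F13.1 // -/b row4 addnS ltnS [(i <= b + k)%N]leq_eqVlt.
  case: eqP => [->|_] //=.
  rewrite ltnNge leq_addr /= ltnn eqn_add2l.
  by case: eqP.
Qed.

(** * Computing the output from the extrema *)

Definition factor_prog (k p q : nat) : cmd :=
  ROp RSub (loc 7 (NConst k) (NConst 0)) (loc 2 (NConst p) (NConst 0)) tmp ;;
  IfR (loc 7 (NConst k) (NConst 0)) (loc 2 (NConst q) (NConst 0))
    Skip (RCopy (loc 7 (NConst k) (NConst 0)) (loc 2 (NConst q) (NConst 0))).

(** Row 1 of array 7 is the factor min(P^- - 1, P^+), common to a'_r, b' and M_i^-. *)
Definition range_prog (a : nat) (dst src : nexp) : cmd :=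
  RCopy (loc a dst (NConst 0)) (loc 6 src (NConst 0)) ;;
  RCopy (loc a dst (NConst 1)) (loc 6 src (NConst 1)) ;;
  ROp RSub acc (loc 6 src (NConst 1)) (loc 6 src (NConst 0)) ;;
  ROp RMul (loc a dst (NConst 2)) (loc 7 (NConst 1) (NConst 0)) acc.

Definition final_prog : cmd :=
  RConst tmp true ;;
  factor_prog 0 1 2 ;;
  factor_prog 1 2 1 ;;
  For (NConst 9) (ic 0) (range_prog 3 (ic 9) (NAdd (ic 1) (ic 9))) ;;
  range_prog 4 (NConst 0) (NAdd (ic 1) (ic 0)) ;;
  For (NConst 12) (ic 1)
    (ROp RSub acc (loc 6 (ic 12) (NConst 1)) (loc 6 (ic 12) (NConst 0)) ;;
     ROp RMul (loc 5 (ic 12) (NConst 0)) (loc 7 (NConst 0) (NConst 0)) acc ;;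
     ROp RMul (loc 5 (ic 12) (NConst 1)) (loc 7 (NConst 1) (NConst 0)) acc).

Definition factor (R : realType) (p q : R) : R :=
  if p - 1 <= q then p - 1 else q.

Lemma runs_final (R : realType) (s : state R) :
  let d := imem s 0 in let b := imem s 1 in
  let ft := factor (rmem s 2 1 0) (rmem s 2 2 0) in
  let ff := factor (rmem s 2 2 0) (rmem s 2 1 0) in
  let lo i := rmem s 6 i 0%N in let hi i := rmem s 6 i 1%N in
  runs final_prog s (2 * d + 3 * b + 6) (fun s' =>
    [/\ forall r, (r < d)%N -> [/\ rmem s' 3 r 0 = lo (b + r)%N,
          rmem s' 3 r 1 = hi (b + r)%N &
          rmem s' 3 r 2 = ff * (hi (b + r)%N - lo (b + r)%N)],
        [/\ rmem s' 4 0 0 = lo (b + d)%N, rmem s' 4 0 1 = hi (b + d)%N &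
          rmem s' 4 0 2 = ff * (hi (b + d)%N - lo (b + d)%N)] &
        forall i, (i < b)%N -> rmem s' 5 i 0 = ft * (hi i - lo i) /\
          rmem s' 5 i 1 = ff * (hi i - lo i)]).
Proof.
move=> d b ft ff lo hi.
(* Each factor takes a subtraction and a comparison, each range a subtraction and a product; a point
   takes one product more, its range being shared by both signs. *)
apply: (@runs_weaken _ _ _ (0 + (2 + (2 + (d * 2 + (2 + b * 3)))))); last 2 first.
- lia.
- by move=> s'; exact.
apply: runs_step; set s1 := (exec _ _).1.
apply: (@runs_seq _ _ _ _ _ _ (fun s2 => [/\ frame [::] [:: 7; 8] s s2,
  rmem s2 8 0 1 = 1 & rmem s2 7 0 0 = ft])).
  rewrite /runs /= /ft /factor; case: (_ <= _) => /=.
    by split=> //; split=> //; frame_tac.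
  by split=> //; split=> //; frame_tac.
move=> s2 [F2 one2 ft2].
apply: (@runs_seq _ _ _ _ _ _ (fun s3 => [/\ frame [::] [:: 7; 8] s s3,
  rmem s3 7 0 0 = ft & rmem s3 7 1 0 = ff])).
  have F2' := F2; case: F2' => ? ?.
  rewrite /runs /= /ff /factor one2 !F2.2 //; case: (_ <= _) => /=.
    by split=> //; split=> //; frame_tac.
  split=> //; split=> //; frame_tac.
move=> s3 [F3 ft3 ff3].
apply: (@runs_seq _ _ _ _ _ _ (fun s4 => [/\ frame [:: 9] [:: 3; 8] s3 s4 &
  forall r, (r < d)%N -> [/\ rmem s4 3 r 0 = lo (b + r)%N,
          rmem s4 3 r 1 = hi (b + r)%N &
          rmem s4 3 r 2 = ff * (hi (b + r)%N - lo (b + r)%N)]])).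
  apply: (@runs_for _ _ _ _ _ _ _ (fun k s4 => [/\ frame [:: 9] [:: 3; 8] s3 s4 &
    forall r, (r < k)%N -> [/\ rmem s4 3 r 0 = lo (b + r)%N,
          rmem s4 3 r 1 = hi (b + r)%N &
          rmem s4 3 r 2 = ff * (hi (b + r)%N - lo (b + r)%N)]])) => //.
    by rewrite /= F3.1.
  move=> k s4 ltk [F4 row4]; split=> //=; split=> //=.
    by case: F4 => ? ?; frame_tac.
  move=> r; rewrite ltnS leq_eqVlt => /orP[/eqP->|ltr]; last first.
    by rewrite (ltn_eqF ltr) /=; exact: row4.
  by rewrite eqxx /= !F4.1 // !F3.1 // !F4.2 // (F3.2 6%N) // ff3.
move=> s4 [F4 row4].
have F34 := F4; case: F34 => Fi4 Fr4.
apply: (@runs_seq _ _ _ _ _ _ (fun s5 => [/\ frame [:: 9] [:: 3; 4; 8] s3 s5,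
  rmem s5 3 = rmem s4 3 &
  [/\ rmem s5 4 0 0 = lo (b + d)%N, rmem s5 4 0 1 = hi (b + d)%N &
          rmem s5 4 0 2 = ff * (hi (b + d)%N - lo (b + d)%N)]])).
  split=> //=; split=> //=.
    have [//|//|? ?] := @frame_sub _ _ _ [:: 9] [:: 3; 4; 8] _ _ F4; frame_tac.
  by rewrite !Fi4 // !F3.1 // !Fr4 // (F3.2 6%N) // ff3.
move=> s5 [F5 r5 row5].
apply: (@runs_weaken _ _ _ (b * 3) _ (fun s6 => [/\ frame [:: 12] [:: 5; 8] s5 s6 &
   forall i, (i < b)%N -> rmem s6 5 i 0 = ft * (hi i - lo i) /\
          rmem s6 5 i 1 = ff * (hi i - lo i)])) => //; last first.
  move=> s6 [F6 row6]; split=> //; last by rewrite F6.2.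
  by move=> r ltr; rewrite F6.2 // r5; exact: row4.
apply: (@runs_for _ _ _ _ _ _ _ (fun k s6 => [/\ frame [:: 12] [:: 5; 8] s5 s6 &
   forall i, (i < k)%N -> rmem s6 5 i 0 = ft * (hi i - lo i) /\
          rmem s6 5 i 1 = ff * (hi i - lo i)])) => //.
  by rewrite /= F5.1 // F3.1.
move=> k s6 ltk [F6 row6]; split=> //=; split=> //=.
  by case: F6 => ? ?; frame_tac.
move=> i; rewrite ltnS leq_eqVlt => /orP[/eqP->|lti]; last first.
  by rewrite (ltn_eqF lti) /=; exact: row6.
by rewrite eqxx /= !F6.2 // !F5.2 // (F3.2 6%N) // ft3 ff3.
Qed.

(** * From codes of tuples and signs to the interpolants *)

Lemma digit_lt b t k : (0 < b)%N -> (digit b t k < b)%N.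
Proof. exact: ltn_pmod. Qed.

(** As in Horner's scheme, [f 0] becomes the least significant digit and the induction hypothesis
    encodes the shifted sequence. *)
Lemma digits_surj b n (f : nat -> nat) :
  (forall k, (k < n)%N -> (f k < b)%N) ->
  exists2 t, (t < b ^ n)%N & forall k, (k < n)%N -> digit b t k = f k.
Proof.
elim: n f => [|n IHn] f ltf; first by exists 0%N.
have [k ltk|t ltt dig] := IHn (fun k => f k.+1); first exact: ltf.
have lt0 := ltf 0%N isT.
exists (t * b + f 0%N)%N.
  rewrite expnSr (leq_trans (n := t.+1 * b)) ?leq_mul2r ?ltt ?orbT //.
  by rewrite mulSn addnC ltn_add2r.
case=> [|k] ltk; first by rewrite /digit expn0 divn1 modnMDl modn_small.
have b_gt0 : (0 < b)%N by exact: leq_ltn_trans lt0.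
by rewrite -dig // /digit expnS divnMA divnMDl // (divn_small lt0) addn0.
Qed.

Lemma independent_solve (R : realType) n (A : nat -> nat -> R) (w : nat -> R) :
  independent n A ->
  exists y : nat -> R, forall l, (l < n)%N -> dot n (A l) y = w l.
Proof.
move=> /independent_unitmx; set M := \matrix_(l, j) _ => unitM.
pose v := invmx M *m (\col_l w l : 'cV_n).
exists (fun j => if insub j is Some j' then v j' 0 else 0) => l ltl.
have /colP/(_ (Ordinal ltl)) : M *m v = \col_l w l by rewrite mulKVmx.
rewrite !mxE => <-; apply: eq_bigr => j _.
by rewrite valK [M _ _]mxE.
Qed.

Definition affine_of (R : realType) (d : nat) (y : nat -> R) (u : 'rV[R]_d) : R :=
  \sum_(r < d) y r * u 0 r + y d.

Lemma affine_of0 (R : realType) (d : nat) (y : nat -> R) :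
  affine_of y (0 : 'rV_d) = y d.
Proof. by rewrite /affine_of big1 ?add0r // => i _; rewrite mxE mulr0. Qed.

(** The difference quotient at 0 equals [y r] for every nonzero h, so the limit is that of an
    eventually constant function. *)
Lemma partial_affine (R : realType) (d : nat) (r : 'I_d) (y : nat -> R) :
  partial r (@affine_of R d y) = y r.
Proof.
rewrite /partial /derive; apply: cvg_lim => //.
apply: cvg_near_cst; near=> h.
have h_neq0 : h != 0 by near: h; exact: nbhs_dnbhs_neq.
rewrite /= addr0 affine_of0.
have -> : affine_of y (h *: (delta_mx 0 r : 'rV_d)) = h * y r + y d.
  rewrite /affine_of (bigD1 r) //= big1 ?addr0 => [|i /negbTE iNr].
    by rewrite !mxE !eqxx mulr1 mulrC.
  by rewrite !mxE iNr andbF !mulr0.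
by rewrite addrK /GRing.scale /= mulKf.
Unshelve. all: by end_near.
Qed.

Lemma dot_point (R : realType) d b (X : nat -> nat -> R) (y : nat -> R) i
    (u : 'rV[R]_d) :
  (i < b)%N -> (forall j : 'I_d, X i j = u 0 j) ->
  dot d.+1 (functional_rows d b X i) y = affine_of y u.
Proof.
move=> lti XE; rewrite /dot big_ord_recr /= /functional_rows lti ltnn eqxx mul1r.
by congr (_ + _); apply: eq_bigr => j _; rewrite ltn_ord XE mulrC.
Qed.

Lemma dot_unit (R : realType) d b (X : nat -> nat -> R) (y : nat -> R) r :
  (r < d.+1)%N -> dot d.+1 (functional_rows d b X (b + r)%N) y = y r.
Proof.
move=> ltr; rewrite /dot (bigD1 (Ordinal ltr)) //= big1 => [|j jNr].
  by rewrite /functional_rows ltnNge leq_addr /= ltn_add2l ltr eqxx mul1r addr0.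
rewrite /functional_rows ltnNge leq_addr /= ltn_add2l ltr eqn_add2l.
suff -> : (j == r :> nat) = false by rewrite mul0r.
exact: negbTE.
Qed.

(** In a vanishing combination of the rows (x_i, 1), the last column says that the coefficients sum
    to 0 and the other columns that the points combine to 0: the two premises of affine
    independence. *)
Lemma independent_rows (R : realType) (d N : nat) (x : 'I_N -> 'rV[R]_d)
    (X : nat -> nat -> R) (f : nat -> nat) :
  (forall (i : 'I_N) (j : 'I_d), X i j = x i 0 j) -> general_position x ->
  (forall k, (k < d.+1)%N -> (f k < N)%N) -> distinct_below f d.+1 ->
  independent d.+1 (fun l => functional_rows d N X (f l)).
Proof.
move=> XE gp ltf inj_f c c0 m ltm.
pose g (k : 'I_d.+1) := Ordinal (ltf k (ltn_ord k)).
have inj_g : injective g.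
  move=> k l /(congr1 val) /= fE; apply/val_inj => /=.
  case: (ltngtP k l) => // ltkl; have := inj_f _ _ _.
    by move=> /(_ l k); rewrite ltkl ltn_ord fE => /(_ isT).
  by move=> /(_ k l); rewrite ltkl ltn_ord fE => /(_ isT).
apply: (gp g inj_g (fun k => c k) _ _ (Ordinal ltm)).
  rewrite -[RHS](c0 d) //; apply: eq_bigr => k _.
  by rewrite /functional_rows ltf // ltnn eqxx mulr1.
apply/rowP => j; rewrite summxE mxE -[RHS](c0 j) ?ltnS ?(ltnW (ltn_ord j)) //.
apply: eq_bigr => k _; rewrite mxE /functional_rows ltf // ltn_ord.
by rewrite -XE.
Qed.

(** An injective tuple gives the subset of its values, and a subset is reached through an
    enumeration of it; signs correspond to binary digits. Several tuples yield the same subset,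
    which is harmless since only the union matters. *)
Lemma Astar_visited (R : realType) (d N : nat) (x : 'I_N -> 'rV[R]_d)
    (z : 'I_N -> R) (eps : R) (X : nat -> nat -> R) (Z : nat -> R) :
  (0 < N)%N ->
  (forall (i : 'I_N) (j : 'I_d), X i j = x i 0 j) ->
  (forall i : 'I_N, Z i = z i) ->
  Astar x z eps = [set affine_of y | y in
    visited d.+1 N (functional_rows d N X) Z eps (N ^ d.+1)].
Proof.
move=> N_gt0 XE ZE; apply/seteqP; split=> g; last first.
  move=> [y [t [q [ltt dist ltq cand]]] <-].
  pose f (k : 'I_d.+1) : 'I_N := Ordinal (digit_lt t k N_gt0).
  have inj_f : injective f.
    move=> k l /(congr1 val) /= fE; apply/val_inj => /=.
    case: (ltngtP k l) => // ltkl; exfalso.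
      by apply: (dist l k) => //; rewrite ltkl ltn_ord.
    by apply: (dist k l) => //; rewrite ltkl ltn_ord.
  exists [set f k | k in 'I_d.+1]%SET => /=; first by rewrite card_imset ?card_ord.
  split.
    by exists (fun r => y r), (y d).
  (* The sign at a point is read at its position in the tuple, which is unique by injectivity of
     [f]. *)
  pose e i := if [pick k | f k == i] is Some k then perturbation eps q k else 0.
  have eE k : e (f k) = perturbation eps q k.
    rewrite /e; case: pickP => [k' /eqP/inj_f -> //|/(_ k)].
    by rewrite eqxx.
  exists [set (x i, z i + e i) | i in [set` [set f k | k in 'I_d.+1]%SET]].
    exists e; split=> // i /imsetP[k _ ->].
    by rewrite eE /perturbation; case: ifP; [right|left].
  move=> _ [i /imsetP[k _ ->] <-] /=.
  rewrite eE -ZE -cand // (@dot_point _ _ _ _ _ _ (x (f k))) ?ltn_pmod //.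
  exact: (XE (f k)).
move=> [I /= cardI [[a [b gE]] [_ [e [eP ->]] interp]]].
pose f (k : nat) : nat := 
  if insub k is Some k' then enum_val (cast_ord (esym cardI) k') else 0%N.
have fE (k : 'I_d.+1) : f k = enum_val (cast_ord (esym cardI) k).
  by rewrite /f valK.
have [t ltt tE] : exists2 t, (t < N ^ d.+1)%N &
    forall k, (k < d.+1)%N -> digit N t k = f k.
  by apply: digits_surj => k ltk; rewrite (fE (Ordinal ltk)) ltn_ord.
(* Digit 1 marks an error different from [eps], hence equal to [- eps]; when [eps] is 0 the two
   signs coincide and all digits are 0. *)
pose s (k : nat) : nat := 
  if insub k is Some k' then e (enum_val (cast_ord (esym cardI) k')) != eps else 0%N.
have sE (k : 'I_d.+1) :
    s k = (e (enum_val (cast_ord (esym cardI) k)) != eps) by rewrite /s valK.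
have [q ltq qE] : exists2 q, (q < 2 ^ d.+1)%N &
    forall k, (k < d.+1)%N -> digit 2 q k = s k.
  by apply: digits_surj => k ltk; rewrite (sE (Ordinal ltk)); case: (_ != _).
pose y (j : nat) := if insub j is Some j' then a j' else b.
have yg : affine_of y = g.
  apply/funext => u; rewrite gE /affine_of; congr (_ + _).
    by apply: eq_bigr => r _; rewrite /y valK.
  by rewrite /y insubF // ltnn.
exists y => //; exists t, q; split=> //.
  move=> k l /andP[ltlk ltk]; have ltl := ltn_trans ltlk ltk.
  rewrite !tE // (fE (Ordinal ltk)) (fE (Ordinal ltl)) => /val_inj/enum_val_inj.
  by move=> /cast_ord_inj/(congr1 val) /= kl; move: ltlk; rewrite kl ltnn.
move=> l ltl; rewrite tE // (fE (Ordinal ltl)); set i := enum_val _.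
rewrite (@dot_point _ _ _ _ _ _ (x i)) // yg ZE.
have iI : i \in I by exact: enum_valP.
rewrite (interp (x i, z i + e i)) /=; last by exists i.
congr (_ + _); rewrite /perturbation qE // (sE (Ordinal ltl)) -/i.
case: (altP (e i =P eps)) => [->|] //=.
by case: (eP i iI) => [->|->]; rewrite ?eqxx.
Qed.

(** * The time bound and the conclusion *)

Lemma sqr_le_exp2 n : (n * n <= 2 * 2 ^ n)%N.
Proof.
(* From n = 3 on, (n + 1)^2 is at most twice n^2; the smaller cases are computed. *)
elim: n => // n IHn; case: (leqP n 2) => [|lt2n]; first by case: n {IHn} => [|[|[|]]].
by rewrite expnS; nia.
Qed.

(** With e = 2^(d+1), the bounds (d+1)^2 <= 2e and d + 1 <= N absorb the cubic cost of Gram-Schmidt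
    into e N d. The constant 60 is 16 for Gram-Schmidt, 30 for solving and updating, and 14 for the
    final stage, whose own estimate is 11 N d. *)
Lemma time_bound d N :
  (1 <= d)%N -> (d.+1 <= N)%N ->
  (N ^ d.+1 * (d.+1 * (4 * d.+1 * d.+1 + 4 * d.+1) +
     2 ^ d.+1 * (d.+1 + d.+1 * (4 * d.+1 + 2) + (N + d.+1) * (2 * d.+1 + 2))) +
   (2 * d + 3 * N + 6) <= 60 * (2 ^ d.+1 * N ^ d.+2 * d))%N.
Proof.
move=> d_gt0 ltdN; rewrite [(N ^ d.+2)%N]expnSr.
have sq := sqr_le_exp2 d.+1.
have a_gt0 : (0 < N ^ d.+1)%N by rewrite expn_gt0; case: N ltdN.
have e_gt0 : (0 < 2 ^ d.+1)%N by rewrite expn_gt0.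
move: (N ^ d.+1)%N (2 ^ d.+1)%N sq a_gt0 e_gt0 => a e sq a_gt0 e_gt0.
have gs : (d.+1 * (4 * d.+1 * d.+1 + 4 * d.+1) <= 16 * (e * (N * d)))%N.
  have : (d.+1 * (d.+1 * d.+1) <= N * (2 * e))%N by exact: leq_mul.
  nia.
have solve : (d.+1 + d.+1 * (4 * d.+1 + 2) + (N + d.+1) * (2 * d.+1 + 2) <=
    30 * (N * d))%N by nia.
have fin : (2 * d + 3 * N + 6 <= 11 * (N * d))%N by nia.
have -> : (60 * (e * (a * N) * d) = a * (16 * (e * (N * d)) + e * (30 * (N * d)))
    + 14 * (a * (e * (N * d))))%N by ring.
apply: leq_add; first by rewrite leq_mul2l leq_add ?orbT // leq_mul2l solve orbT.
apply: leq_trans fin _; apply: leq_mul => //.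
by rewrite mulnA leq_pmull // muln_gt0 a_gt0.
Qed.

Lemma factorE (R : realType) (p q : nat) :
  (1 <= p)%N -> factor p%:R q%:R = (minn (p - 1) q)%:R :> R.
Proof.
move=> p_gt0; rewrite /factor.
have -> : p%:R - 1 = (p - 1)%:R :> R by rewrite natrB.
by rewrite ler_nat /minn; case: ltngtP => // ->.
Qed.

Theorem proposition2 :
  exists (prog : cmd) (C : nat),
  forall (R : realType) (d N : nat) (x : 'I_N -> 'rV[R]_d) (z : 'I_N -> R)
    (eps : R) (P : bool -> nat),
    (1 <= d)%N -> (d.+1 <= N)%N -> general_position x -> 0 <= eps ->
    (forall c, (1 <= P c)%N) ->
    let: (final, time) := exec prog (input x z eps P) in
    is_bounds x z eps P (output d N final) /\
    (time <= C * (2 ^ d.+1 * N ^ d.+2 * d))%N.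
Proof.
exists (init_prog ;; main_prog ;; final_prog), 60%N.
move=> R d N x z eps P d_gt0 ltdN gp _ P_gt0.
set s := input x z eps P.
suff : runs (init_prog ;; main_prog ;; final_prog) s
    (60 * (2 ^ d.+1 * N ^ d.+2 * d)) (fun s' => is_bounds x z eps P (output d N s')).
  by rewrite /runs; case: (exec _ _).
(* Initialisation is free; the budgets of the two other stages are filled in by unification with
   [time_bound]. *)
apply: (@runs_weaken _ _ _ (0 + (_ + _))); last 2 first.
- exact: time_bound.
- by move=> s'; exact.
have N_gt0 : (0 < N)%N by exact: leq_trans ltdN.
pose X := rmem s 0; pose Z i := rmem s 1 i 0%N.
have XE (i : 'I_N) (j : 'I_d) : X i j = x i 0 j by rewrite /X /= !valK.
have ZE (i : 'I_N) : Z i = z i by rewrite /Z /= valK.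
have init_s : runs init_prog s 0 (fun s' =>
    [/\ frame [:: 2; 3; 4; 9; 11; 12] [:: 10] s s', imem s' 2 = d.+1,
        imem s' 3 = (N ^ d.+1)%N, imem s' 4 = (2 ^ d.+1)%N &
        rmem s' 10 = functional_rows d N X]).
  exact: (@runs_init _ s (fun _ _ => erefl)).
apply: (runs_seq init_s) => {init_s} s1 [F1 n1 p1 q1 E1].
have N1 : imem s1 1 = N by rewrite F1.1.
have main1 := @runs_main _ s1.
rewrite /= n1 N1 p1 q1 E1 (F1.2 1%N) // (F1.2 2%N) // in main1.
have indep t : distinct_below (digit N t) d.+1 ->
    independent d.+1 (fun l => functional_rows d N X (digit N t l)).
  by apply: (independent_rows XE gp) => k _; exact: digit_lt.
apply: (runs_seq (main1 _ _ _ indep)) => {main1} //.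
- by rewrite F1.1.
- by move=> i j; rewrite F1.2.
move=> s2 [Fi2 Fr2 ext2].
have d2 : imem s2 0 = d by rewrite Fi2 // F1.1.
have N2 : imem s2 1 = N by rewrite Fi2.
have final2 := @runs_final _ s2.
rewrite /= d2 N2 (Fr2 2%N) // (F1.2 2%N) //= !factorE // in final2.
apply: (runs_weaken final2) => {final2} // s3 [outa outb outM].
set V := visited _ _ _ _ _ _ in ext2.
have AV : Astar x z eps = [set affine_of y | y in V] by exact: Astar_visited.
(* As N >= d + 1, the identity is an injective tuple, and its system with sign code 0 is solvable.
   Hence the flag in cell 7 is set at the end and array 6 holds true extrema. *)
have V_neq0 : (V !=set0).
  have [|t ltt tE] := @digits_surj N d.+1 id.
    by move=> k ltk; exact: leq_trans ltdN.
  have dist : distinct_below (digit N t) d.+1.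
    move=> k l /andP[ltlk ltk]; rewrite !tE // ?(ltn_trans ltlk) // => kl.
    by rewrite kl ltnn in ltlk.
  have [y yP] := independent_solve
    (fun l => Z (digit N t l) + perturbation eps 0 l) (indep t dist).
  by exists y, t, 0%N; split=> //; rewrite expn_gt0.
have {}ext2 : forall i, (i < N + d.+1)%N ->
    is_min [set dot d.+1 (functional_rows d N X i) y | y in V] (rmem s2 6 i 0%N) /\
    is_max [set dot d.+1 (functional_rows d N X i) y | y in V] (rmem s2 6 i 1%N).
  move: ext2; rewrite /extrema; case: ifP => // _ V0.
  by move: V_neq0; rewrite V0 => -[].
(* Partial derivatives, the value at 0 and the values at the points are all dot products with rows
   of array 10, so one transfer of images serves the three families. *)
have img (F : ('rV[R]_d -> R) -> R) i :
    (forall y, F (affine_of y) = dot d.+1 (functional_rows d N X i) y) ->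
    [set F g | g in Astar x z eps] =
    [set dot d.+1 (functional_rows d N X i) y | y in V].
  move=> FE; rewrite AV image_comp.
  by apply: eq_imagel => y _; rewrite /= FE.
split.
- move=> r; have [lo hi diff] := outa r (ltn_ord r).
  have ltr : (N + r < N + d.+1)%N by rewrite ltn_add2l ltnS ltnW.
  rewrite (@img _ (N + r)%N) => [|y]; last first.
    by rewrite partial_affine dot_unit // ltnS ltnW.
  have [mi ma] := ext2 _ ltr.
  by rewrite /= lo hi diff; split.
- have [lo hi diff] := outb.
  have ltd : (N + d < N + d.+1)%N by rewrite ltn_add2l.
  rewrite (@img (fun g => g 0) (N + d)%N) => [|y]; last first.
    by rewrite affine_of0 dot_unit.
  have [mi ma] := ext2 _ ltd.
  by rewrite /= lo hi diff; split.
- move=> i c; have [Mt Mf] := outM i (ltn_ord i).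
  have lti : (i < N + d.+1)%N by exact: ltn_addr.
  exists (rmem s2 6 i 0%N), (rmem s2 6 i 1%N).
  rewrite (@img (fun g => g (x i)) i) => [|y]; last first.
    by rewrite (@dot_point _ _ _ _ _ _ (x i)).
  have [mi ma] := ext2 _ lti.
  by split=> //; case: c => /=.
Qed.
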